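(* Let $\lambda$ be a strict partition of length $\le n$ and $X\in\{B,C,D\}$ (with $n$ even when $X=D$). Then $$GX^{(n)}_\lambda(x|b)=\sum_{D\in\mathcal{E}^X_n(\lambda)}wt^X(D),\qquad wt^X(D)=\prod_{(i,j)\in D}wt^X(i,j)\prod_{(i',j')\in B^X(D)}\big(1+\beta\,wt^X(i',j')\big).$$
   Context: $\beta$ indeterminate; $x\oplus y=x+y+\beta xy$, $x\ominus y=(x-y)/(1+\beta y)$. For strict $\lambda=(\lambda_1>\dots>\lambda_r>0)$, $r\le n$: $GP_\lambda(x_1,\dots,x_n|b)=\frac1{(n-r)!}\sum_{w\in S_n}w\big[\prod_{j=1}^r\prod_{k=1}^{\lambda_j}(x_j\oplus b_k)\prod_{i=1}^r\prod_{j=i+1}^n\frac{x_i\oplus x_j}{x_i\ominus x_j}\big]$; $GQ_\lambda$ the same with $(x_j\oplus x_j)\prod_{k=1}^{\lambda_j-1}(x_j\oplus b_k)$. $GB^{(n)}_\lambda=GP_\lambda(x_1,\dots,x_n|0,b_1,b_2,\dots)$, $GC^{(n)}_\lambda=GQ_\lambda(x_1,\dots,x_n|b)$, $GD^{(n)}_\lambda=GP_\lambda(x_1,\dots,x_n|b)$ ($n$ even). $\mathcal{D}_n=\{(i,j)\in\mathbb{Z}^2:1\le i\le n,\ i\le j\}$; $\mathbb{D}(\lambda)=\{(i,j):1\le i\le r,\ i\le j\le\lambda_i+i-1\}$. For a finite $D\subset\mathcal{D}_n$: if $(i,j)\in D$ and $(i+1,j),(i+1,j+1),(i,j+1)\notin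 D$ (the condition on $(i+1,j)$ being vacuous when $i=j$), then $D'=(D\setminus\{(i,j)\})\cup\{(i+1,j+1)\}$ is an elementary excitation of $D$. $\mathcal{E}^I_n(\lambda)$ is the set of subsets of $\mathcal{D}_n$ obtained from $\mathbb{D}(\lambda)$ by finite sequences of elementary excitations. For $D\in\mathcal{E}^I_n(\lambda)$, $B^I(D)$ is the set of $(i,j)$ such that: $(i,j)\notin D$; there is $k\ge1$ with $(i+k,j+k)\in D$, $(i+s,j+s)\notin D$ for $1\le s<k$, $(i+s,j+s+1)\notin D$ for $0\le s<k$, and (if $i\ne j$) $(i+s-1,j+s)\notin D$ for $0\le s<k$. Type II: a diagonal box $(i,i)\in D$ with $(i,i+1),(i+1,i+1),(i+1,i+2),(i+2,i+2)\notin D$ may be moved to $(i+2,i+2)$; off-diagonal boxes excite as before; $\mathcal{E}^{II}_n(\lambda)$ is the set of diagrams obtained from $\mathbb{D}(\lambda)$ using ordinary elementary excitations for off-diagonal boxes and only these type II moves for diagonal boxes; $B^{II}(D)$ is defined as $B^I(D)$ but requiring $k$ even. $\mathcal{E}^B_n=\mathcal{E}^C_n=\mathcal{E}^I_n$, $\mathcal{E}^D_n=\mathcal{E}^{II}_n$, $B^B=B^C=B^I$, $B^D=B^{II}$. Weights: $wt^B(i,j)=x_i$ if $j\le n$, $x_i\oplus b_{j-n}$ if $j>n$; $wt^C(i,j)=x_i\oplus x_j$ if $j\le n$, $x_i\oplus b_{j-n}$ if $j>n$; $wt^D(i,j)=x_i\oplus x_{j+1}$ if $j\le n-1$, $x_i\oplus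 b_{j-n+1}$ if $j\ge n$.
   Formalization: Three formulas of the setting, false as written, are corrected: wt^B(i,j) is x_i only for i=j and x_i⊕x_j for i<j≤n; B^I requires (i+s+1,j+s)∉D instead of (i+s-1,j+s)∉D; in B^II, k must be even only for diagonal boxes. *)

(* Defs.v *)
From Stdlib Require Import Relation_Operators.
From HB Require Import structures.
From mathcomp Require Import all_boot all_order all_fingroup all_algebra finmap.
From mathcomp Require Import boolp classical_sets cardinality fsbigop.
Set Implicit Arguments.
Unset Strict Implicit.
Unset Printing Implicit Defensive.
Import GRing.Theory.
Local Open Scope classical_set_scope.
Local Open Scope fset_scope.
Local Open Scope ring_scope.

(* The variables x_1, x_2, ... and parameters b_1, b_2, ... are sequences
   [x b : nat -> F] indexed from 1; the value at 0 is never used.  Boxes (i, j)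
   are 1-based as well, but parts of a partition are stored in a 0-based [seq]:
   lambda_i is [nth 0 la i.-1].

   beta, the x_i and the b_k are arbitrary elements of a field F.  The case of
   indeterminates is F = Q(beta, x_1, ..., x_n, b_1, b_2, ...). *)

Definition strict_partition (la : seq nat) : bool :=
  sorted gtn la && (0%N \notin la).

Definition oplus (F : fieldType) (beta x y : F) : F := x + y + beta * x * y.

Definition ominus (F : fieldType) (beta x y : F) : F :=
  (x - y) / (1 + beta * y).

Definition cross_factor (F : fieldType) (beta : F) (n r : nat)
    (y : 'I_n -> F) : F :=
  \prod_(i < n | (i < r)%N) \prod_(j < n | (i < j)%N)
    (oplus beta (y i) (y j) / ominus beta (y i) (y j)).

Definition GP (F : fieldType) (beta : F) (n : nat) (la : seq nat)
    (x b : nat -> F) : F :=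
  ((n - size la)`!%:R)^-1 *
  \sum_(w : 'S_n)
    let y (i : 'I_n) := x (w i).+1 in
    (\prod_(j < n | (j < size la)%N)
       \prod_(1 <= k < (nth 0%N la j).+1) oplus beta (y j) (b k)) *
    cross_factor beta (size la) y.

Definition GQ (F : fieldType) (beta : F) (n : nat) (la : seq nat)
    (x b : nat -> F) : F :=
  ((n - size la)`!%:R)^-1 *
  \sum_(w : 'S_n)
    let y (i : 'I_n) := x (w i).+1 in
    (\prod_(j < n | (j < size la)%N)
       (oplus beta (y j) (y j) *
        \prod_(1 <= k < nth 0%N la j) oplus beta (y j) (b k))) *
    cross_factor beta (size la) y.

(* (0, b_1, b_2, ...), indexed from 1. *)
Definition shift0 (F : fieldType) (b : nat -> F) (k : nat) : F :=
  if (k <= 1)%N then 0 else b k.-1.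

Variant lie_type := TypeB | TypeC | TypeD.

Definition GX (F : fieldType) (X : lie_type) (beta : F) (n : nat)
    (la : seq nat) (x b : nat -> F) : F :=
  match X with
  | TypeB => GP beta n la x (shift0 b)
  | TypeC => GQ beta n la x b
  | TypeD => GP beta n la x b
  end.

Definition diagram := {fset nat * nat}.

Definition region (n : nat) (c : nat * nat) : bool :=
  (1 <= c.1 <= n)%N && (c.1 <= c.2)%N.

Definition shifted_diagram (la : seq nat) : diagram :=
  [fset c in [seq (i, j) | i <- iota 1 (size la),
                           j <- iota i (nth 0%N la i.-1)]].

Definition excitable (D : diagram) (i j : nat) : Prop :=
  [/\ (i, j) \in D, (i <> j -> (i.+1, j) \notin D),
      (i.+1, j.+1) \notin D & (i, j.+1) \notin D].

Definition move_box (D : diagram) (c c' : nat * nat) : diagram :=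
  c' |` (D `\ c).

Definition exciteI (n : nat) (D D' : diagram) : Prop :=
  exists i j : nat,
    [/\ excitable D i j, region n (i.+1, j.+1)
      & D' = move_box D (i, j) (i.+1, j.+1)].

Definition exciteII (n : nat) (D D' : diagram) : Prop :=
  (exists i j : nat,
    [/\ i <> j, excitable D i j, region n (i.+1, j.+1)
      & D' = move_box D (i, j) (i.+1, j.+1)]) \/
  (exists i : nat,
    [/\ (i, i) \in D,
        [/\ (i, i.+1) \notin D, (i.+1, i.+1) \notin D,
            (i.+1, i.+2) \notin D & (i.+2, i.+2) \notin D],
        region n (i.+2, i.+2)
      & D' = move_box D (i, i) (i.+2, i.+2)]).

Definition excited (X : lie_type) (n : nat) (la : seq nat) : set diagram :=
  let step := match X with TypeB | TypeC => exciteI n | TypeD => exciteII n end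
  in [set D | clos_refl_trans diagram step (shifted_diagram la) D].

(* The box (i + k, j + k) of D can be slid back to (i, j): no other box of D
   lies on the way, immediately to its right, or (off the diagonal) immediately
   below it. *)
Definition slides_back (D : diagram) (i j k : nat) : Prop :=
  [/\ (1 <= k)%N, ((i + k)%N, (j + k)%N) \in D,
      (forall s : nat, (1 <= s < k)%N -> ((i + s)%N, (j + s)%N) \notin D),
      (forall s : nat, (s < k)%N -> ((i + s)%N, (j + s).+1) \notin D)
    & (i <> j ->
       forall s : nat, (s < k)%N -> ((i + s).+1, (j + s)%N) \notin D)].

(* Only diagonal boxes move by two steps in type D, so the parity condition on
   k concerns only them. *)
Definition back_boxes (X : lie_type) (n : nat) (D : diagram) :
    set (nat * nat) :=
  [set c | [/\ region n c, c \notin D &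
     exists2 k : nat, slides_back D c.1 c.2 k &
       X = TypeD -> c.1 = c.2 -> ~~ odd k]].

Definition box_weight (F : fieldType) (X : lie_type) (beta : F) (n : nat)
    (x b : nat -> F) (c : nat * nat) : F :=
  let: (i, j) := c in
  match X with
  | TypeB => if i == j then x i
             else if (j <= n)%N then oplus beta (x i) (x j)
             else oplus beta (x i) (b (j - n)%N)
  | TypeC => if (j <= n)%N then oplus beta (x i) (x j)
             else oplus beta (x i) (b (j - n)%N)
  | TypeD => if (j < n)%N then oplus beta (x i) (x j.+1)
             else oplus beta (x i) (b (j - n).+1)
  end.

(* [back_boxes] and [excited] are finite sets (every box lies in the rows
   1, ..., n, on a diagonal j - i met by the initial diagram), so the
   finitely-supported big operators are plain products and sums over them. *)
Definition diagram_weight (F : fieldType) (X : lie_type) (beta : F) (n : nat)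
    (x b : nat -> F) (D : diagram) : F :=
  (\prod_(c <- D) box_weight X beta n x b c) *
  \big[*%R/1]_(c \in back_boxes X n D)
    (1 + beta * box_weight X beta n x b c).

(* Main.v *)
(* An excited diagram is a semistandard filling [f] of the shifted shape
   lambda, [f q d] being the row reached by the box of row [q] and content [d].
   Let Z_(n,k) be the sum over the fillings whose boxes lie in the rows
   0, ..., n - 1, or in row [n] with content < [k].  Only a removable box of
   content [k] can use the new box (n, k) of weight w, and summing over its
   positions telescopes, since
     1 + beta * sum_t w_t * prod_(m < t) (1 + beta * w_m)
       = prod_t (1 + beta * w_t),
   so that
     Z_(n,k+1)(lambda) = (1 + beta * w) Z_(n,k)(lambda)
                         + w Z_(n,k)(lambda minus that box),
   and Z_(n,k+1) = Z_(n,k) when there is no such box.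

   The symmetrization in n + 1 variables obeys the same recursion, with
   (-)x_n inserted among the parameters: exchanging it with the next parameter
   c is the above step with w = x_n (+) c, and once it stands in first position
   the variable x_n can no longer be used, which leaves the symmetrization in n
   variables with x_n as first parameter. *)

From Stdlib Require Import Relation_Operators.
Require Import Defs.
From HB Require Import structures.
From mathcomp Require Import all_boot all_order all_fingroup all_algebra finmap.
From mathcomp Require Import boolp classical_sets cardinality fsbigop.
From mathcomp Require Import ring zify.
Set Implicit Arguments.
Unset Strict Implicit.
Unset Printing Implicit Defensive.
Import GRing.Theory.
Local Open Scope ring_scope.

(** * The operations x ⊕ y and x ⊖ y *)

(** The obstacle is content 0, where the exchange of parameters breaks down. In types B and C every
    part carries a factor [g0] that is not an exchangeable parameter, so a part 1 can still use x_n
    when the inverse of x_n stands first. In type D a diagonal box moves by two rows, so the first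
    exchange must act for one parity of n only. Both are settled by closed forms for a single part
    1: its symmetrization is the ⊕-sum of the values of [g0] in types B and C, and in type D it
    depends on the parameter only when the number of variables is odd. They are proved by
    interpolation in a parameter at the ⊕-inverses of the variables, where one variable drops out.
    When k + 1 and k are both parts, nothing can be removed; this case rests on a two-variable
    identity whose value does not involve the exchanged parameter. Since earlier parts consume
    variables, the identities are stated for arbitrary sets of variables and for an iterated sum,
    which also absorbs the factor 1/(n-r)! that would change when a part disappears. *)

Section OplusTheory.
Variables (F : fieldType) (beta : F).
Local Notation "x ⊕ y" := (oplus beta x y) (at level 50, left associativity).
Local Notation "x ⊖ y" := (ominus beta x y) (at level 50, left associativity).

Lemma oplusA : associative (oplus beta).
Proof. by move=> x y z; rewrite /oplus; ring. Qed.

Lemma oplusC : commutative (oplus beta).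
Proof. by move=> x y; rewrite /oplus; ring. Qed.

Lemma oplus0x : left_id 0 (oplus beta).
Proof. by move=> x; rewrite /oplus; ring. Qed.

HB.instance Definition _ :=
  Monoid.isComLaw.Build F 0 (oplus beta) oplusA oplusC oplus0x.

Lemma oplus_ominus x y : 1 + beta * y != 0 -> x ⊕ (0 ⊖ y) = x ⊖ y.
Proof. by move=> hy; rewrite /oplus /ominus; field. Qed.

Lemma ominusxx x : x ⊖ x = 0.
Proof. by rewrite /ominus subrr mul0r. Qed.

Lemma ominusK x y : 1 + beta * y != 0 -> (0 ⊖ y) ⊕ (x ⊕ y) = x.
Proof. by move=> hy; rewrite /oplus /ominus; field. Qed.

Lemma ominus_neq0 x y : 1 + beta * y != 0 -> x != y -> x ⊖ y != 0.
Proof. by move=> hy hxy; rewrite /ominus mulf_neq0 ?invr_eq0 ?subr_eq0. Qed.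

Lemma ominus0_inj x y : 1 + beta * x != 0 -> 1 + beta * y != 0 ->
  0 ⊖ x = 0 ⊖ y -> x = y.
Proof.
move=> hx hy /eqP; rewrite /ominus eqr_div // => /eqP h.
have -> : x = - ((0 - x) * (1 + beta * y)) - beta * x * y by ring.
by rewrite h; ring.
Qed.

(** Over the denominator x - y, [u] enters both terms through u (1 + beta x) (1 + beta y), with
    opposite signs. This independence of [u] makes an exchange invisible to two consecutive
    parts. *)
Lemma cross_sum x y u : 1 + beta * x != 0 -> 1 + beta * y != 0 -> x != y ->
  (x ⊕ u) * ((x ⊕ y) / (x ⊖ y)) + (y ⊕ u) * ((y ⊕ x) / (y ⊖ x)) = x ⊕ y.
Proof.
move=> hx hy hxy; rewrite /oplus /ominus.
have h1 : x - y != 0 by rewrite subr_eq0.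
have h2 : y - x != 0 by rewrite subr_eq0 eq_sym.
by field; rewrite hx hy h1 h2.
Qed.

Lemma affine_eq (p q r s u1 u2 u : F) : u1 != u2 ->
  p + q * u1 = r + s * u1 -> p + q * u2 = r + s * u2 -> p + q * u = r + s * u.
Proof.
move=> hu h1 h2.
have hq : q = s.
  apply/eqP; rewrite -subr_eq0; have : (q - s) * (u1 - u2) = 0.
    have -> : (q - s) * (u1 - u2) =
      (p + q * u1) - (p + q * u2) - (r + s * u1) + (r + s * u2) by ring.
    by rewrite h1 h2; ring.
  by move/eqP; rewrite mulf_eq0 (subr_eq0 u1) (negbTE hu) orbF.
by move: h1; rewrite hq => /addIr ->.
Qed.

End OplusTheory.

(** * Symmetrizations as iterated sums over the variables *)

Section CrossSum.
Variables (F : fieldType) (beta : F) (I : finType) (x : I -> F).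
Hypotheses (x_inj : injective x) (x_unit : forall i, 1 + beta * x i != 0).
Local Notation "x ⊕ y" := (oplus beta x y) (at level 50, left associativity).
Local Notation "x ⊖ y" := (ominus beta x y) (at level 50, left associativity).
Local Notation cr i j := ((x i ⊕ x j) / (x i ⊖ x j)).

(* The symmetrization with the factors [fs], summed over cosets: the first factor
   chooses its variable in [A], the second one among the remaining ones, etc. *)
Fixpoint cross_sum_seq (fs : seq (F -> F)) (A : {set I}) : F :=
  if fs is f :: fs' then
    \sum_(i in A) f (x i) * (\prod_(j in A :\ i) cr i j) *
                  cross_sum_seq fs' (A :\ i)
  else 1.
Local Notation H := cross_sum_seq.

Lemma cross_sum_cons f fs (A : {set I}) :
  H (f :: fs) A =
  \sum_(i in A) f (x i) * (\prod_(j in A :\ i) cr i j) * H fs (A :\ i).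
Proof. by []. Qed.

Lemma x_neq i j : i != j -> x i != x j.
Proof. by apply: contraNneq => /x_inj ->. Qed.

Lemma xom_neq0 i j : i != j -> x i ⊖ x j != 0.
Proof. by move=> h; apply: ominus_neq0 => //; exact: x_neq. Qed.

Lemma xom_inj i j : i != j -> 0 ⊖ x i != 0 ⊖ x j.
Proof.
by apply: contraNneq => /ominus0_inj h; apply/eqP/x_inj/h.
Qed.

Lemma two_in_set (A : {set I}) : (1 < #|A|)%N ->
  exists i j, [/\ i \in A, j \in A & i != j].
Proof. by move=> /card_gt1P[i [j [? ? ?]]]; exists i, j. Qed.

(** At the inverse of [x e] the term of [e] vanishes, and in the others x i ⊖ x e cancels the
    denominator of [k i e]. The functions [g], [h], [k] are left free so that both closed forms
    below can use the same reduction. *)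
Lemma one_part_reduce (A : {set I}) e (g h : I -> F) (k : I -> I -> F) :
  e \in A -> (forall i, i != e -> (x i ⊖ x e) * k i e = h i) ->
  \sum_(i in A) (x i ⊕ (0 ⊖ x e)) * g i * (\prod_(j in A :\ i) k i j) =
  \sum_(i in A :\ e) h i * g i * (\prod_(j in (A :\ e) :\ i) k i j).
Proof.
move=> eA hk; rewrite (big_setD1 e) //= oplus_ominus // ominusxx !mul0r add0r.
apply: eq_bigr => i; rewrite !inE => /andP[ie iA].
have eAi : e \in A :\ i by rewrite !inE eq_sym ie.
rewrite (big_setD1 e) //= oplus_ominus // -hk // !mulrA.
have -> : (A :\ i) :\ e = (A :\ e) :\ i.
  by apply/setP=> l; rewrite !inE andbCA.
by rewrite (mulrAC _ (g i)).
Qed.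

(* Both sides are affine in [u] and agree at all the [0 ⊖ x e], by induction. *)
Lemma one_part_sum (A : {set I}) u :
  \sum_(i in A) (x i ⊕ u) * (\prod_(j in A :\ i) cr i j) =
  (if odd #|A| then u else 0) ⊕ \big[oplus beta/0]_(i in A) x i.
Proof.
move En : #|A| => n; elim: n A u En => [|n IH] A u En.
  by rewrite (cards0_eq En) !big_set0 /= Monoid.mulm1.
(* Interpolation needs two distinct nodes, so a singleton is treated apart. *)
case: n => [|n] in IH En *.
  have /cards1P[i ->] : #|A| == 1 by rewrite En.
  by rewrite !big_set1 finset.setDv big_set0 mulr1 oplusC.
have [e1 [e2 [h1 h2 h12]]] : exists i j, [/\ i \in A, j \in A & i != j].
  by apply: two_in_set; rewrite En.
have key e : e \in A ->
    \sum_(i in A) (x i ⊕ (0 ⊖ x e)) * (\prod_(j in A :\ i) cr i j) =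
    (if odd n.+2 then 0 ⊖ x e else 0) ⊕ \big[oplus beta/0]_(i in A) x i.
  move=> eA.
  under eq_bigr do rewrite -[x _ ⊕ _]mulr1.
  rewrite (one_part_reduce _ (h := fun i => x i ⊕ x e)) //; last first.
    by move=> i ie; rewrite mulrC divfK ?xom_neq0.
  under eq_bigr do rewrite mulr1.
  (* Deleting [e] turns the parameter 0 ⊖ x e into x e, while the parity of the set flips: x e is
     either supplied by the parameter or cancelled by its inverse. *)
  rewrite IH; last by move: En; rewrite (cardsD1 e A) eA => -[].
  rewrite [in RHS](big_setD1 e) //= negbK.
  case: (odd n) => /=; last by rewrite oplus0x.
  rewrite oplus0x (oplusC beta (x e)) oplusC.
  by rewrite -{1}[bigop _ _ _](@ominusK _ beta _ (x e)) // oplusC.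
have lin v : \sum_(i in A) (x i ⊕ v) * (\prod_(j in A :\ i) cr i j) =
   \sum_(i in A) x i * (\prod_(j in A :\ i) cr i j) +
   (\sum_(i in A) (1 + beta * x i) * (\prod_(j in A :\ i) cr i j)) * v.
  rewrite mulr_suml -big_split /=; apply: eq_bigr => i _.
  by rewrite /oplus; ring.
have lin2 v : (if odd n.+2 then v else 0) ⊕ \big[oplus beta/0]_(i in A) x i =
   \big[oplus beta/0]_(i in A) x i +
   (if odd n.+2 then 1 + beta * \big[oplus beta/0]_(i in A) x i else 0) * v.
  by case: ifP => _; rewrite /oplus; ring.
rewrite lin lin2.
by apply: (affine_eq _ (xom_inj h12)); rewrite -lin -lin2 key.
Qed.

(* Again an interpolation in the first element of [ps] at the [0 ⊖ x e]. *)
Lemma multi_part_sum (A : {set I}) (ps : seq F) : size ps = #|A| ->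
  \sum_(i in A) (\prod_(u <- ps) (x i ⊕ u)) / (\prod_(j in A :\ i) (x i ⊖ x j)) =
  (\big[oplus beta/0]_(u <- ps) u) ⊕ \big[oplus beta/0]_(i in A) x i.
Proof.
elim: ps A => [|u ps IH] A En.
  by rewrite (cards0_eq (esym En)) big_nil !big_set0 /= Monoid.mulm1.
have [/size0nil ps0|ps_gt0] := posnP (size ps).
  have /cards1P[i ->] : #|A| == 1 by rewrite -En ps0.
  by rewrite ps0 !big_seq1 !big_set1 finset.setDv big_set0 divr1 big_seq1 oplusC.
have [e1 [e2 [h1 h2 h12]]] : exists i j, [/\ i \in A, j \in A & i != j].
  by apply: two_in_set; rewrite -En.
have key e : e \in A ->
    \sum_(i in A) (\prod_(u <- (0 ⊖ x e) :: ps) (x i ⊕ u)) /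
                  (\prod_(j in A :\ i) (x i ⊖ x j)) =
    (\big[oplus beta/0]_(u <- (0 ⊖ x e) :: ps) u) ⊕
      \big[oplus beta/0]_(i in A) x i.
  move=> eA.
  under eq_bigr do rewrite big_cons -prodfV.
  rewrite (one_part_reduce _ (h := fun=> 1)) //; last first.
    by move=> i ie; rewrite mulfV ?xom_neq0.
  under eq_bigr do rewrite mul1r prodfV.
  rewrite IH; last by move: En; rewrite (cardsD1 e A) eA => -[].
  rewrite [in RHS](big_setD1 e) //= big_cons.
  rewrite -{1}[\big[_/_]_(i in A :\ e) _](@ominusK _ beta _ (x e)) //.
  by rewrite /oplus; ring.
have lin v : \sum_(i in A) (\prod_(u <- v :: ps) (x i ⊕ u)) /
                  (\prod_(j in A :\ i) (x i ⊖ x j)) =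
   \sum_(i in A) x i * (\prod_(u <- ps) (x i ⊕ u)) /
                  (\prod_(j in A :\ i) (x i ⊖ x j)) +
   (\sum_(i in A) (1 + beta * x i) * (\prod_(u <- ps) (x i ⊕ u)) /
                  (\prod_(j in A :\ i) (x i ⊖ x j))) * v.
  rewrite mulr_suml -big_split /=; apply: eq_bigr => i _.
  rewrite big_cons {1}/oplus; set P := \prod_(u <- _) _.
  by set Q := (\prod_(j in _) _)^-1; ring.
have lin2 v : (\big[oplus beta/0]_(u <- v :: ps) u) ⊕
    \big[oplus beta/0]_(i in A) x i =
  (\big[oplus beta/0]_(u <- ps) u) ⊕ \big[oplus beta/0]_(i in A) x i +
  (1 + beta * ((\big[oplus beta/0]_(u <- ps) u) ⊕
     \big[oplus beta/0]_(i in A) x i)) * v.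
  rewrite big_cons /=; move: (\big[_/_]_(j <- ps) j) (\big[_/_]_(i in A) x i) => p q.
  by rewrite /oplus; ring.
rewrite lin lin2.
by apply: (affine_eq _ (xom_inj h12)); rewrite -lin -lin2 key.
Qed.

(** Taking the variables themselves as the parameters of [multi_part_sum] produces the factor x i ⊕
    x i and all the numerators of the cross factors. *)
Lemma double_part_sum (A : {set I}) :
  \sum_(i in A) (x i ⊕ x i) * (\prod_(j in A :\ i) cr i j) =
  \big[oplus beta/0]_(i in A) (x i ⊕ x i).
Proof.
have := @multi_part_sum A [seq x j | j in A]; rewrite size_image => /(_ erefl).
rewrite big_image /= -big_split /= => <-; apply: eq_bigr => i iA.
by rewrite big_image /= [in RHS](big_setD1 i iA) /= -mulrA -prodf_div.
Qed.

(** The prefix only selects variables, so a linear relation between tails passes through it. The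
    cardinality of [B] is recorded because the type D relation depends on its parity. *)
Lemma cross_sum_prefix (pre fs fs1 fs2 : seq (F -> F)) (a c : F) (A : {set I}) :
  (forall B : {set I}, (#|B| + size pre = #|A|)%N ->
     H fs B = a * H fs1 B + c * H fs2 B) ->
  H (pre ++ fs) A = a * H (pre ++ fs1) A + c * H (pre ++ fs2) A.
Proof.
elim: pre A => [|f pre IH] A h /=; first by apply: h; rewrite addn0.
rewrite !mulr_sumr -big_split /=; apply: eq_bigr => i iA.
rewrite IH; first by move: (H _ _) (H _ _) => p q; ring.
by move=> B hB; apply: h; rewrite addnS hB (cardsD1 i A) iA.
Qed.

Lemma cross_sum_prefix_eq (pre fs fs1 : seq (F -> F)) (A : {set I}) :
  (forall B : {set I}, (#|B| + size pre = #|A|)%N -> H fs B = H fs1 B) ->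
  H (pre ++ fs) A = H (pre ++ fs1) A.
Proof.
move=> h; rewrite (@cross_sum_prefix pre fs fs1 fs1 1 0).
  by rewrite mul1r mul0r addr0.
by move=> B /h ->; rewrite mul1r mul0r addr0.
Qed.

(* Twice the left-hand side is the sum over ordered pairs of variables of an
   expression in which the two orders combine by [cross_sum]. *)
Lemma cross_sum_adjacent (g : F -> F) (u v : F) fs (A : {set I}) :
  2%:R != 0 :> F ->
  H ((fun y => (y ⊕ u) * g y) :: g :: fs) A =
  H ((fun y => (y ⊕ v) * g y) :: g :: fs) A.
Proof.
move=> two_neq0.
pose R i j := g (x i) * g (x j) *
  ((\prod_(l in (A :\ i) :\ j) cr i l) * (\prod_(l in (A :\ i) :\ j) cr j l)) *
  H fs ((A :\ i) :\ j).
have RC i j : R i j = R j i.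
  rewrite /R (mulrC (g (x i))).
  have -> : (A :\ i) :\ j = (A :\ j) :\ i by apply/setP=> l; rewrite !inE andbCA.
  by congr (_ * _ * _); rewrite mulrC.
have expand w : H ((fun y => (y ⊕ w) * g y) :: g :: fs) A =
    \sum_(i in A) \sum_(j in A | j != i) (x i ⊕ w) * cr i j * R i j.
  rewrite cross_sum_cons; apply: eq_bigr => i iA; rewrite cross_sum_cons mulr_sumr.
  apply: eq_big => [j|j]; rewrite !inE 1?andbC // => /andP[jA ji].
  rewrite (big_setD1 j) /=; last by rewrite !inE ji.
  by rewrite /R; move: (H fs _) => h; ring.
have double w : 2%:R * H ((fun y => (y ⊕ w) * g y) :: g :: fs) A =
    \sum_(i in A) \sum_(j in A | j != i) (x i ⊕ x j) * R i j.
  rewrite mulr_natl mulr2n {2}expand expand.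
  rewrite [X in _ + X](exchange_big_dep (mem A)) /=; last by move=> i j _ /andP[].
  rewrite -big_split /=; apply: eq_bigr => i iA.
  rewrite [X in _ + X](eq_bigl (fun j => (j \in A) && (j != i))); last first.
    by move=> j; rewrite iA eq_sym.
  rewrite -big_split /=; apply: eq_bigr => j /andP[_ ji].
  by rewrite (RC j i) -mulrDl cross_sum // x_neq // eq_sym.
by apply: (mulfI two_neq0); rewrite !double.
Qed.

(** The factors in [s] vanish at [x e], so they leave [e] to the tail, and each absorbs its cross
    factor with [e]. The tail is allowed to become a linear combination because it may use [e]
    itself. *)
Lemma cross_sum_reduce (T : eqType) (f g : T -> F -> F) (s : seq T)
    (tl tl1 tl2 : seq (F -> F)) (a c : F) e (A : {set I}) :
  e \in A ->
  (forall l, l \in s -> f l (x e) = 0) ->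
  (forall l i, l \in s -> i != e -> f l (x i) * cr i e = g l (x i)) ->
  (forall B : {set I}, e \in B -> H tl B = a * H tl1 (B :\ e) + c * H tl2 (B :\ e)) ->
  H (map f s ++ tl) A =
  a * H (map g s ++ tl1) (A :\ e) + c * H (map g s ++ tl2) (A :\ e).
Proof.
move=> eA; elim: s A eA => [|l s IH] A eA hf hg htl /=; first exact: htl.
rewrite (big_setD1 e) //= hf ?mem_head // !mul0r add0r !mulr_sumr -big_split /=.
apply: eq_bigr => i; rewrite !inE => /andP[ie iA].
have eAi : e \in A :\ i by rewrite !inE eq_sym ie.
rewrite (big_setD1 e) //= (mulrA (f l _)) hg ?mem_head //.
have -> : (A :\ i) :\ e = (A :\ e) :\ i by apply/setP=> k; rewrite !inE andbCA.
rewrite IH //; last 2 first.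
- by move=> k hk; apply: hf; rewrite inE hk orbT.
- by move=> k j hk; apply: hg; rewrite inE hk orbT.
have -> : (A :\ i) :\ e = (A :\ e) :\ i by apply/setP=> k; rewrite !inE andbCA.
by move: (H _ _) (H _ _) => p q; ring.
Qed.

End CrossSum.

(* The permutations agreeing with a given [w0] on the first [k] indices are
   summed by decreasing [k]. *)
Section PermSum.
Variables (F : fieldType) (beta : F) (n : nat) (x : 'I_n -> F).
Variable fs : seq (F -> F).
Local Notation cr i j :=
  (oplus beta (x i) (x j) / ominus beta (x i) (x j)).
Local Notation H := (cross_sum_seq beta x).

Let agree k (w0 w : 'S_n) := [forall j : 'I_n, (j < k)%N ==> (w j == w0 j)].
Let tail k (w : 'S_n) := [set w j | j : 'I_n & (k <= j)%N].

Let agreeP k (w0 w : 'S_n) :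
  reflect (forall j : 'I_n, (j < k)%N -> w j = w0 j) (agree k w0 w).
Proof.
apply: (iffP forallP) => h j; first by move=> hj; apply/eqP; exact: (implyP (h j)).
by apply/implyP => hj; rewrite h.
Qed.

Let mem_tail k (w : 'S_n) (j : 'I_n) : (w j \in tail k w) = (k <= j)%N.
Proof. by rewrite mem_imset ?inE //; exact: perm_inj. Qed.

Let mem_tailV k (w : 'S_n) i : (i \in tail k w) = (k <= w^-1%g i)%N.
Proof. by rewrite -{1}[i](permKV w) mem_tail. Qed.

Let tailS (k : 'I_n) (w : 'S_n) : tail k.+1 w = tail k w :\ w k.
Proof.
apply/setP => i; rewrite -[i](permKV w); move: (w^-1%g i) => j.
by rewrite !inE !mem_tail (inj_eq perm_inj) ltn_neqAle eq_sym.
Qed.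

Let card_tail d k w : (k + d = n)%N -> #|tail k w| = d.
Proof.
elim: d k => [|d IH] k hk.
  apply/eqP; rewrite cards_eq0; apply/eqP/setP => i.
  rewrite -[i](permKV w) mem_tail inE; apply/negbTE; rewrite -ltnNge.
  by have := ltn_ord (w^-1%g i); lia.
have kn : (k < n)%N by lia.
rewrite (cardsD1 (w (Ordinal kn))) mem_tail leqnn -(tailS (Ordinal kn)).
by rewrite IH //=; lia.
Qed.

Let term (w : 'S_n) (i : 'I_n) : F :=
  nth (fun=> 0) fs i (x (w i)) * \prod_(j < n | (i < j)%N) cr (w i) (w j).

(** Composing [w0] with the transposition of [w0 o] and [i] changes the value at [o] to [i] and
    keeps the earlier values, none of which is [i]. *)
Let agreeS (o : 'I_n) (w0 : 'S_n) i (w : 'S_n) : i \in tail o w0 ->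
  agree o.+1 (w0 * tperm (w0 o) i)%g w = agree o w0 w && (w o == i).
Proof.
move=> iT.
have key (j : 'I_n) : (j < o)%N -> (w0 * tperm (w0 o) i)%g j = w0 j.
  move=> jo; rewrite permM tpermD //.
    by rewrite (inj_eq perm_inj) -val_eqE /=; lia.
  by apply: contraTneq iT => ->; rewrite mem_tail; lia.
apply/agreeP/andP => [h|[/agreeP h /eqP wo] j].
  split; last by rewrite h // permM tpermL.
  by apply/agreeP => j jo; rewrite h ?key //; lia.
rewrite ltnS leq_eqVlt => /predU1P[/val_inj -> |jo]; last by rewrite h // key.
by rewrite permM tpermL.
Qed.

Let tail_tperm (o : 'I_n) (w0 : 'S_n) i : i \in tail o w0 ->
  tail o.+1 (w0 * tperm (w0 o) i)%g = tail o w0 :\ i.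
Proof.
move=> iT; have w0o : w0 o \in tail o w0 by rewrite mem_tail.
have -> : tail o w0 = tail o (w0 * tperm (w0 o) i)%g.
  apply/setP => l; rewrite -[in RHS](tpermK (w0 o) i l) -[tperm _ _ l in RHS](permKV w0).
  rewrite -permM mem_tail -(mem_tail o w0) permKV.
  by case: tpermP => [->|->|]; rewrite ?w0o ?iT.
by rewrite tailS permM tpermL.
Qed.

Let term_tail (o : 'I_n) (w : 'S_n) :
  term w o = nth (fun=> 0) fs o (x (w o)) * \prod_(j in tail o w :\ w o) cr (w o) j.
Proof.
rewrite /term -tailS /tail big_imset /=; last by move=> ? ? _ _; exact: perm_inj.
by congr (_ * _); apply: eq_bigl => j; rewrite inE.
Qed.

Let agree_tail (o : 'I_n) (w0 w : 'S_n) : agree o w0 w -> tail o w = tail o w0.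
Proof.
move=> /agreeP h; apply/setP => l.
have sub (v v' : 'S_n) : (forall j : 'I_n, (j < o)%N -> v j = v' j) ->
    l \in tail o v -> l \in tail o v'.
  move=> hv; rewrite !mem_tailV; apply: contraTT; rewrite -!ltnNge => hl.
  suff -> : (v^-1%g l) = (v'^-1%g l) by [].
  by apply: (@perm_inj _ v); rewrite permKV hv // permKV.
by apply/idP/idP; apply: sub => // j /h.
Qed.

Let sum_agree d k w0 : (size fs <= n)%N -> (k + d = n)%N ->
  \sum_(w | agree k w0 w) \prod_(i < n | (k <= i)%N && (i < size fs)%N) term w i =
  (n - maxn k (size fs))`!%:R * H (drop k fs) (tail k w0).
Proof.
move=> hr; elim: d k w0 => [|d IH] k w0 hk.
  rewrite (big_pred1 w0); last first.
    move=> w /=; apply/agreeP/eqP => [h|-> //].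
    by apply/permP => j; apply: h; have := ltn_ord j; lia.
  rewrite big_pred0; last by move=> j; have := ltn_ord j; lia.
  have -> : (n - maxn k (size fs) = 0)%N by lia.
  by rewrite mul1r drop_oversize; last lia.
have kn : (k < n)%N by lia.
pose o := Ordinal kn.
rewrite (partition_big (fun w : 'S_n => w o) (mem (tail k w0))) /=; last first.
  by move=> w /(@agree_tail o) <-; rewrite mem_tail.
under eq_bigr => i iT.
  under eq_bigl do rewrite -(@agreeS o) //.
  over.
have [kr|rk] := ltnP k (size fs).
  rewrite (drop_nth (fun=> 0)) // cross_sum_cons mulr_sumr.
  apply: eq_bigr => i iT.
  transitivity (\sum_(w | agree k.+1 (w0 * tperm (w0 o) i)%g w)
    (nth (fun=> 0) fs k (x i) * \prod_(j in tail k w0 :\ i) cr i j) *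
    \prod_(i < n | (k.+1 <= i)%N && (i < size fs)%N) term w i).
    apply: eq_bigr => w; rewrite (@agreeS o) // => /andP[/agree_tail hw /eqP wo].
    rewrite (bigD1 o) /= ?leqnn // term_tail hw wo; congr (_ * _).
    by apply: eq_bigl => j; rewrite -val_eqE /=; lia.
  rewrite -mulr_sumr IH; last lia.
  rewrite (@tail_tperm o) //.
  have -> : (maxn k.+1 (size fs) = size fs)%N by lia.
  by rewrite mulrCA.
(* No factor is left: all choices of the next value contribute equally, and counting them builds up
   the factorial. *)
transitivity (\sum_(i in tail k w0) ((n - k.+1)`!%:R : F)).
  apply: eq_bigr => i iT.
  have := IH k.+1 (w0 * tperm (w0 o) i)%g.
  rewrite (maxn_idPl (leqW rk)) (drop_oversize (leqW rk)) mulr1 => <-; last lia.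
  by apply: eq_bigr => w _; apply: eq_bigl => j; lia.
rewrite sumr_const (card_tail _ hk) drop_oversize // mulr1.
have -> : (n - k = d.+1)%N by lia.
have -> : (n - k.+1 = d)%N by lia.
by rewrite factS natrM mulrC mulr_natr.
Qed.

Lemma sum_perm_cross : (size fs <= n)%N ->
  \sum_(w : 'S_n)
    (\prod_(j < n | (j < size fs)%N) nth (fun=> 0) fs j (x (w j))) *
    cross_factor beta (size fs) (fun i => x (w i)) =
  (n - size fs)`!%:R * H fs [set: 'I_n].
Proof.
move=> hr; have := @sum_agree n 0 1%g hr (add0n n); rewrite max0n drop0.
have -> : tail 0 1%g = [set: 'I_n].
  by apply/setP => i; rewrite -[i](permKV 1%g) mem_tail inE.
move=> <-; apply: eq_big => [w|w _]; first by apply/esym/agreeP.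
by rewrite /cross_factor -big_split.
Qed.

End PermSum.

(** * Sums over shifted semistandard fillings *)

(* [l q] is the length of row [q]; the truncated predecessor also forces the rows
   below an empty row to be empty. *)
Definition strict_shape (l : nat -> nat) := forall q, (l q.+1 <= (l q).-1)%N.

Lemma strict_shape_lt l q q' : strict_shape l ->
  (q < q')%N -> (0 < l q')%N -> (l q' < l q)%N.
Proof.
move=> hl; elim: q' => // q' IH; rewrite ltnS leq_eqVlt => /predU1P[->|qq'] h.
  by have := hl q'; lia.
by have := hl q'; have := IH qq'; lia.
Qed.

Lemma strict_shape_inj l q q' : strict_shape l -> (0 < l q)%N ->
  l q = l q' -> q = q'.
Proof.
move=> hl h e; case: (ltngtP q q') => // qq'.
  by have := strict_shape_lt hl qq'; lia.
by have := strict_shape_lt hl qq'; lia.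
Qed.

Lemma big_nat_recr_cond (R : Type) (idx : R) (op : Monoid.com_law idx)
    (P : pred nat) (E : nat -> R) u v : (u <= v)%N ->
  \big[op/idx]_(u <= m < v.+1 | P m) E m =
  op (\big[op/idx]_(u <= m < v | P m) E m) (if P v then E v else idx).
Proof. by move=> uv; rewrite big_mkcond big_nat_recr //= -big_mkcond. Qed.

Section Tableaux.
Variables (F : fieldType) (beta : F) (w : nat -> nat -> F) (isD : bool).

(** In type D a diagonal box starts in row [q] and moves by two rows, so it only meets rows of the
    parity of [q]. *)
Definition parity_ok (q d m : nat) : bool := isD && (d == 0%N) ==> (odd m == odd q).

(* The box on the left of (q, d) is (q, d - 1), the one above it is
   (q - 1, d + 1): rows increase weakly and columns strictly. *)
Definition lower_bound (f : nat -> nat -> nat) (q d : nat) : nat :=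
  maxn (if d is d'.+1 then f q d' else 0%N)
       (if q is q'.+1 then (f q' d.+1).+1 else 0%N).

(** The value 0 off the shape makes a filling determined by its boxes. The row bound depends on the
    content because the recursion admits one new box at a time. *)
Definition tableau (N l : nat -> nat) (f : nat -> nat -> nat) : Prop :=
  forall q d, if (d < l q)%N
    then [/\ (lower_bound f q d <= f q d)%N, (f q d < N d)%N & parity_ok q d (f q d)]
    else f q d = 0%N.

(** The product runs over the rows to which the box can slide back, that is over the back boxes it
    accounts for; see [back_boxesE]. *)
Definition box_factor (f : nat -> nat -> nat) (q d : nat) : F :=
  w (f q d) d *
  \prod_(lower_bound f q d <= m < f q d | parity_ok q d m) (1 + beta * w m d).

Definition column_sum (q d u v : nat) : F :=
  \sum_(u <= t < v | parity_ok q d t)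
     w t d * \prod_(u <= m < t | parity_ok q d m) (1 + beta * w m d).

Lemma column_sum_telescope q d u v : (u <= v)%N ->
  \prod_(u <= m < v | parity_ok q d m) (1 + beta * w m d) =
  1 + beta * column_sum q d u v.
Proof.
rewrite /column_sum => /subnKC <-; elim: (v - u)%N => [|n IH].
  by rewrite addn0 !big_geq // mulr0 addr0.
rewrite addnS !big_nat_recr_cond ?leq_addr //= IH.
by case: ifP => _; ring.
Qed.

Lemma column_sumS q d u n : (u <= n)%N -> parity_ok q d n ->
  column_sum q d u n.+1 =
  (1 + beta * w n d) * column_sum q d u n + w n d.
Proof.
move=> un pn; rewrite {1}/column_sum big_nat_recr_cond //= pn.
by rewrite column_sum_telescope // -/(column_sum q d u n); ring.
Qed.

Section Bounded.
Variable M : nat.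
Local Notation filling := {ffun 'I_M.+1 * 'I_M.+1 -> 'I_M.+1}.

(** Fillings are encoded over a fixed finite square, so that a single finite type serves all shapes
    bounded by [M]; the default is the value prescribed off the shape. *)
Definition entry (a : filling) (q d : nat) : nat :=
  if (q <= M)%N && (d <= M)%N then nat_of_ord (a (inord q, inord d)) else 0%N.

Definition shape_weight (l : nat -> nat) (f : nat -> nat -> nat) : F :=
  \prod_(q < M.+1) \prod_(d < l q) box_factor f q d.

Definition tableau_sum (N l : nat -> nat) : F :=
  \sum_(a : filling | `[< tableau N l (entry a) >]) shape_weight l (entry a).

Definition set_entry (a : filling) (c : 'I_M.+1 * 'I_M.+1) (t : 'I_M.+1) : filling :=
  [ffun b => if b == c then t else a b].

Lemma entry_set a (p k : 'I_M.+1) t q d :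
  entry (set_entry a (p, k) t) q d =
  if (q == p :> nat) && (d == k :> nat) then nat_of_ord t else entry a q d.
Proof.
rewrite /entry ffunE -pair_eqE /pair_eq /= -!val_eqE /=.
case: ifP => [/andP[hq hd]|h]; first by rewrite !inordK //; case: ifP.
case: ifP => // /andP[/eqP hq /eqP hd].
by move: h; rewrite hq hd !leq_ord.
Qed.

Lemma entry_inj a a' : entry a =2 entry a' -> a = a'.
Proof.
move=> h; apply/ffunP => -[q d]; have := h q d.
by rewrite /entry !leq_ord !inord_val => /val_inj.
Qed.

(** * Removal of a corner box *)

Section Corner.
Variables (N l : nat -> nat) (p k : 'I_M.+1).
Hypotheses (lp : l p = k.+1) (lp1 : (l p.+1 <= k.-1)%N).
Hypothesis NM : (N k <= M.+1)%N.
Let l' q := if q == p :> nat then nat_of_ord k else l q.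

(** The corner is neither on the left of nor above another box of the shape, so its entry influences
    no lower bound. *)
Lemma lower_bound_corner f g q d :
  (d < l q)%N -> (forall q d, ~~ ((q == p :> nat) && (d == k :> nat)) -> f q d = g q d) ->
  lower_bound f q d = lower_bound g q d.
Proof.
move=> dq h; rewrite /lower_bound; congr maxn.
  case: d dq => // d dq; apply: h; apply/negP => /andP[/eqP qp /eqP dk].
  by move: dq; rewrite qp lp dk; lia.
case: q dq => // q dq; congr _.+1; apply: h; apply/negP => /andP[/eqP qp /eqP dk].
by move: dq; rewrite qp; lia.
Qed.

Lemma tableau_corner f g :
  (forall q d, ~~ ((q == p :> nat) && (d == k :> nat)) -> f q d = g q d) ->
  g p k = 0%N ->
  tableau N l f <->
  tableau N l' g /\ [/\ (lower_bound g p k <= f p k)%N, (f p k < N k)%N & parity_ok p k (f p k)].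
Proof.
move=> fg gpk; split=> [h|[h hc] q d].
  split=> [q d|]; last first.
    have := h p k; rewrite lp ltnSn (lower_bound_corner _ fg) //.
    by rewrite lp.
  have := h q d; rewrite /l'.
  have [qp|qp] := eqVneq q (p : nat).
    rewrite qp lp ltnS leq_eqVlt.
    have [-> /=|dk /=] := eqVneq d (k : nat); first by rewrite ltnn.
    case: ifP => [dk'|_]; last by rewrite fg // eqxx.
    rewrite (lower_bound_corner _ fg) ?fg ?eqxx ?dk //.
    by rewrite lp; lia.
  case: ifP => [dq|_]; last by rewrite fg // (negbTE qp).
  by rewrite (lower_bound_corner _ fg) // fg // (negbTE qp).
have [/andP[/eqP -> /eqP ->]|qd] := boolP ((q == p :> nat) && (d == k :> nat)).
  rewrite lp ltnSn (lower_bound_corner _ fg) //.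
  by rewrite lp.
have := h q d; rewrite /l' fg //.
have [qp|qp] := eqVneq q (p : nat).
  move: qd; rewrite qp eqxx /= => dk; have -> : (d < l p)%N = (d < k)%N by lia.
  case: ifP => // dk'; rewrite (lower_bound_corner _ fg) //.
  by rewrite lp; lia.
by case: ifP => // dq; rewrite (lower_bound_corner _ fg).
Qed.

Lemma shape_weight_corner f g :
  (forall q d, ~~ ((q == p :> nat) && (d == k :> nat)) -> f q d = g q d) ->
  shape_weight l f = shape_weight l' g *
    (w (f p k) k * \prod_(lower_bound g p k <= m < f p k | parity_ok p k m)
       (1 + beta * w m k)).
Proof.
move=> fg; rewrite /shape_weight (bigD1 p) //= [in RHS](bigD1 p) //=.
have eqf q d : (d < l q)%N -> ~~ ((q == p :> nat) && (d == k :> nat)) ->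
    box_factor f q d = box_factor g q d.
  by move=> dq h; rewrite /box_factor (lower_bound_corner dq fg) fg.
rewrite lp /l' eqxx big_ord_recr /= [LHS]mulrAC.
congr (_ * _ * _).
- apply: eq_bigr => d _; apply: eqf; first by rewrite lp; have := ltn_ord d; lia.
  by rewrite eqxx /=; have := ltn_ord d; lia.
- apply: eq_bigr => q qp; have qp' : (q == p :> nat) = false by apply/negbTE.
  rewrite qp'; apply: eq_bigr => d _; apply: eqf => //.
  by rewrite qp'.
- by rewrite /box_factor (lower_bound_corner _ fg) ?lp.
Qed.

Lemma tableau_sum_corner :
  tableau_sum N l =
  \sum_(a : filling | `[< tableau N l' (entry a) >])
    shape_weight l' (entry a) * column_sum p k (lower_bound (entry a) p k) (N k).
Proof.
rewrite /tableau_sum.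
have colE a : column_sum p k (lower_bound (entry a) p k) (N k) =
    \sum_(t < M.+1 | [&& lower_bound (entry a) p k <= t, t < N k & parity_ok p k t]%N)
      w t k * \prod_(lower_bound (entry a) p k <= m < t | parity_ok p k m)
         (1 + beta * w m k).
  rewrite /column_sum big_geq_mkord.
  rewrite (@big_ord_widen_cond _ _ _ (N k) M.+1
    (fun t => parity_ok p k t && (lower_bound (entry a) p k <= t)%N)
    (fun t => w t k * \prod_(lower_bound (entry a) p k <= m < t | parity_ok p k m)
         (1 + beta * w m k)) NM).
  by apply: eq_bigl => t; rewrite -andbA andbC andbA.
under [RHS]eq_bigr do rewrite colE mulr_sumr.
rewrite pair_big_dep /=.
(* A filling of [l] amounts to a filling of [l'], with 0 at the corner, together with the corner
   entry; the side condition of the reindexing is exactly this 0. *)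
rewrite (reindex_onto (fun at_ : filling * 'I_M.+1 => set_entry at_.1 (p, k) at_.2)
   (fun a => (set_entry a (p, k) ord0, a (p, k)))) /=; last first.
  by move=> a _; apply/ffunP => b; rewrite !ffunE; case: eqP => // ->.
have eqS (a : filling) t q d : ~~ ((q == p :> nat) && (d == k :> nat)) ->
    entry (set_entry a (p, k) t) q d = entry a q d.
  by move=> h; rewrite entry_set (negbTE h).
have cE (a : filling) t : entry (set_entry a (p, k) t) p k = t.
  by rewrite entry_set !eqxx.
have setK (a : filling) t : (entry a p k == 0%N) =
    (set_entry (set_entry a (p, k) t) (p, k) ord0 == a).
  apply/eqP/eqP => [a0|<-]; last by rewrite cE.
  apply: entry_inj => q d; rewrite !entry_set.
  have [/andP[/eqP -> /eqP ->]|//] := boolP ((q == p :> nat) && (d == k :> nat)).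
  by rewrite a0.
apply: eq_big => [[a t]|[a t] _] /=.
  have cE' : set_entry a (p, k) t (p, k) = t by rewrite ffunE eqxx.
  rewrite cE' xpair_eqE eqxx andbT -setK.
  apply/andP/andP => [[/asboolP ha /eqP a0]|[/asboolP ha /and3P[h1 h2 h3]]].
    move/(tableau_corner (eqS a t) a0): ha => [ha []]; rewrite cE => -> -> ->.
    by split=> //; apply/asboolP.
  have a0 : entry a p k = 0%N by have := ha p k; rewrite /l' eqxx ltnn.
  rewrite a0; split => //; apply/asboolP/(tableau_corner (eqS a t) a0).
  by rewrite cE.
by rewrite (shape_weight_corner (eqS a t)) cE.
Qed.

End Corner.

(* Row bounds for fillings in the rows 0, ..., n - 1 and in the boxes of row [n] of
   content < [k]. *)
Definition partial_rows (n k d : nat) : nat := n + (d < k)%N.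

(** A box in row [n] with content [k] has no right neighbour, which would need a row at least [n]
    where the bound is still [n], and no neighbour below, which would need a row beyond [n]. It is
    thus a corner, and its parity is right. *)
Lemma tableau_partial_rowsS n k l f :
  strict_shape l ->
  (forall p, l p = k.+1 -> (l p.+1 <= k.-1)%N -> ~~ parity_ok p k n) ->
  tableau (partial_rows n k.+1) l f <-> tableau (partial_rows n k) l f.
Proof.
move=> lS nocorner; split=> h q d; have := h q d; case: ifP => // dq [h1 h2 h3];
  split=> //; move: h2; rewrite /partial_rows; last lia.
have [dk|dk] := eqVneq d k; last by lia.
subst d; rewrite ltnn ltnSn addn0 addn1 ltnS leq_eqVlt => /predU1P[fn|//].
have lk : l q = k.+1.
  apply/eqP; rewrite eqn_leq dq andbT leqNgt; apply/negP => kq.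
  have := h q k.+1; rewrite kq /lower_bound /= fn /partial_rows => -[+ + _]; lia.
have lk1 : (l q.+1 <= k.-1)%N.
  rewrite leqNgt; apply/negP => kq.
  have k_gt0 : (0 < k)%N by have := lS q; lia.
  have := h q.+1 k.-1; rewrite kq /lower_bound prednK // fn /partial_rows => -[+ + _].
  by case: (k.-1) => [|k']; lia.
by have := nocorner q lk lk1; rewrite -fn h3.
Qed.

Lemma tableau_sum_noncorner n k l :
  strict_shape l ->
  (forall p, l p = k.+1 -> (l p.+1 <= k.-1)%N -> ~~ parity_ok p k n) ->
  tableau_sum (partial_rows n k.+1) l = tableau_sum (partial_rows n k) l.
Proof.
move=> lS h; apply: eq_bigl => a.
by apply: asbool_equiv_eq; apply: tableau_partial_rowsS.
Qed.

Lemma tableau_sum_corner_step n (p k : 'I_M.+1) l :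
  strict_shape l -> l p = k.+1 -> (l p.+1 <= k.-1)%N -> (n <= M)%N ->
  parity_ok p k n ->
  tableau_sum (partial_rows n k.+1) l =
  (1 + beta * w n k) * tableau_sum (partial_rows n k) l +
  w n k * tableau_sum (partial_rows n k)
            (fun q => if q == p :> nat then nat_of_ord k else l q).
Proof.
move=> lS lp lp1 nM pn; set l' := fun q => _.
have l'S : strict_shape l'.
  move=> q; rewrite /l'.
  have [qp1|_] := eqVneq q.+1 (p : nat).
    by have -> : (q == p :> nat) = false; have := lS q; rewrite ?qp1 ?lp; lia.
  have [->|_] := eqVneq q (p : nat); last exact: lS.
  by [].
rewrite !(tableau_sum_corner lp lp1) /partial_rows; try lia.
rewrite ltnn ltnSn addn0 addn1.
(* The shortened shape has no row of length k + 1, so admitting the box (n, k) gives it no new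
   filling. *)
rewrite (eq_bigl (fun a => `[< tableau (partial_rows n k) l' (entry a) >])); last first.
  move=> a; apply: asbool_equiv_eq; apply: tableau_partial_rowsS => // q.
  rewrite /l'; case: eqP => [_|/eqP qp lq]; first by lia.
  by move: qp; rewrite (@strict_shape_inj l q p) ?eqxx // ?lq ?lp.
rewrite !mulr_sumr -big_split /=; apply: eq_bigr => a /asboolP ha.
rewrite column_sumS //; first by ring.
rewrite /lower_bound geq_max; apply/andP; split.
  case Ek: (nat_of_ord k) => [//|k'].
  by have := ha p k'; rewrite /l' eqxx Ek ltnSn /partial_rows => -[_ + _]; lia.
case Ep: (nat_of_ord p) => [//|q].
have qp : (q == q.+1) = false by lia.
have kq : (k.+1 < l q)%N by have := lS q; rewrite -Ep lp; lia.
by have := ha q k.+1; rewrite /l' Ep qp kq /partial_rows => -[_ + _]; lia.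
Qed.

End Bounded.
End Tableaux.

(** * The recursion for symmetrizations *)

Lemma strict_partition_cat pre k post :
  strict_partition (pre ++ k :: post) =
  [&& all [pred l | k < l]%N pre, all [pred l | l < k]%N post, (0 < k)%N,
      strict_partition pre & strict_partition post].
Proof.
have gtn_trans : transitive gtn by move=> a b c /= ab bc; exact: ltn_trans bc ab.
rewrite /strict_partition !sorted_pairwise // pairwise_cat /= allrel_consr.
rewrite mem_cat inE !negb_or eq_sym -lt0n.
apply/idP/idP.
  by case/andP => /and4P[/andP[-> _] -> -> ->] /and3P[-> -> ->].
case/and5P => h1 h2 -> /andP[-> ->] /andP[-> ->]; rewrite h1 h2 !andbT /=.
by apply/allrelP => a b /(allP h1) /= ha /(allP h2) /= hb; exact: ltn_trans ha.
Qed.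

Lemma strict_partition_nth la : strict_partition la -> strict_shape (nth 0%N la).
Proof.
move=> /andP[/(sortedP 0%N) h _] q.
have [hq|hq] := ltnP q.+1 (size la); last by rewrite [X in (X <= _)%N]nth_default.
by have /= := h q hq; lia.
Qed.

(** Removing a box of content [k] leaves the part [k], except for k = 0, where the part disappears
    because strict partitions contain no 0. *)
Variant corner_spec (k : nat) (la : seq nat) : Prop :=
  | NoPart of k.+1 \notin la
  | NoCorner pre post of (0 < k)%N & la = pre ++ k.+1 :: k :: post
      & {in pre, forall l, k.+1 < l}%N & {in post, forall l, l < k}%N
  | Corner pre post of la = pre ++ k.+1 :: post
      & {in pre, forall l, k.+1 < l}%N & {in post, forall l, l < k}%N
      & ((0 < k)%N -> strict_partition (pre ++ k :: post))
      & (k = 0%N -> post = [::] /\ strict_partition pre).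

Lemma cornerP k la : strict_partition la -> corner_spec k la.
Proof.
move=> sla; have [|] := boolP (k.+1 \in la); last by exact: NoPart.
move=> hk; case/splitPr: hk sla => pre post.
rewrite strict_partition_cat => /and5P[h1 h2 _ h3 h4].
have pre_gt : {in pre, forall l, k.+1 < l}%N by move=> l /(allP h1).
case: post h2 h4 => [|l post] h2 h4.
  apply: (@Corner k _ pre [::]) => // k_gt0.
  rewrite strict_partition_cat k_gt0 h3 /= !andbT.
  by apply/allP => l /pre_gt /=; lia.
move: h4; rewrite -[l :: post]cat0s strict_partition_cat /= => /and3P[h5 l_gt0 h6].
have post_lt : {in post, forall l', l' < l}%N by move=> l' /(allP h5).
move: h2 => /= /andP[hl h2].
have [lk|lk] := eqVneq l k.
  by rewrite lk in post_lt l_gt0 *; apply: (@NoCorner k _ pre post).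
apply: (@Corner k _ pre (l :: post)) => //.
- move=> l'; rewrite inE => /predU1P[->|/post_lt]; lia.
- move=> k_gt0; rewrite strict_partition_cat; apply/and5P; split=> //.
  + by apply/allP => l' /pre_gt /=; lia.
  + by rewrite /=; apply/andP; split; [lia|apply/allP => l' /post_lt /=; lia].
  + by rewrite -[l :: post]cat0s strict_partition_cat; apply/and5P; split.
by move=> k0; lia.
Qed.

(* The factor of a part [l]; [s] is 1 in types B and C, where [g0] takes the place of
   one of the [l] factors, and 0 in type D. *)
Definition part_factor (F : fieldType) (beta : F) (s : nat) (g0 : F -> F)
    (e : nat -> F) (l : nat) (y : F) : F :=
  g0 y * \prod_(j < l - s) oplus beta y (e j).

Definition swap_seq (T : Type) (e : nat -> T) (t j : nat) : T :=
  if j == t then e t.+1 else if j == t.+1 then e t else e j.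

(** * Exchange of two consecutive parameters *)

Section Exchange.
Variables (F : fieldType) (beta : F) (I : finType) (x : I -> F).
Variables (s : nat) (g0 : F -> F).
Local Notation "x ⊕ y" := (oplus beta x y) (at level 50, left associativity).
Local Notation "x ⊖ y" := (ominus beta x y) (at level 50, left associativity).
Local Notation H := (cross_sum_seq beta x).
Local Notation phi e := (part_factor beta s g0 e).
Implicit Types (e : nat -> F) (A : {set I}).

(** A part is symmetric in the l - s parameters it uses, so the exchange is felt only if exactly one
    of the two is among them. *)
Lemma part_factor_swap e t l : l != (t + s).+1 -> phi (swap_seq e t) l = phi e l.
Proof.
move=> hl; apply: funext => y; rewrite /part_factor; congr (_ * _).
have [lt|lt] := leqP (l - s) t.
  apply: eq_bigr => j _; have := ltn_ord j; rewrite /swap_seq => jl.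
  by rewrite !ifN //; lia.
have lt2 : (t.+2 <= l - s)%N by lia.
rewrite -!(big_mkord xpredT (fun j => _ ⊕ _ j)).
rewrite !(@big_cat_nat _ _ _ t 0 (l - s)) //=; last 2 first.
- by lia.
- by lia.
rewrite !(@big_ltn _ _ _ t (l - s)) //=; try lia.
rewrite !(@big_ltn _ _ _ t.+1 (l - s)) //=; try lia.
congr (_ * _); first apply: eq_big_nat => j jl.
  by rewrite /swap_seq !ifN //; lia.
rewrite !mulrA; congr (_ * _); last first.
  by apply: eq_big_nat => j jl; rewrite /swap_seq !ifN //; lia.
by rewrite /swap_seq !eqxx ifN 1?mulrC //; lia.
Qed.

Lemma part_factorS e t : phi e (t + s).+1 = (fun y => (y ⊕ e t) * phi e (t + s) y).
Proof.
apply: funext => y; rewrite /part_factor addnK -addSn addnK big_ord_recr /=.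
by rewrite mulrA mulrC.
Qed.

Lemma part_factorS_swap e t :
  phi (swap_seq e t) (t + s).+1 = (fun y => (y ⊕ e t.+1) * phi e (t + s) y).
Proof.
rewrite part_factorS part_factor_swap; last by lia.
by rewrite /swap_seq eqxx.
Qed.

Lemma cross_sum_swap_nopart e t la A : (t + s).+1 \notin la ->
  H (map (phi (swap_seq e t)) la) A = H (map (phi e) la) A.
Proof.
move=> hla; congr (H _ A); apply/eq_in_map => l ll.
by apply: part_factor_swap; apply: contraNneq hla => <-.
Qed.

(** With c = e t, one has y ⊕ c ⊕ a = (1 + beta a) (y ⊕ c) + a; in the last term the part loses its
    last parameter and becomes t + s. *)
Lemma cross_sum_swap_corner e t a pre post A : e t.+1 = e t ⊕ a ->
  {in pre, forall l, (t + s).+1 < l}%N -> {in post, forall l, l < t + s}%N ->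
  H (map (phi (swap_seq e t)) (pre ++ (t + s).+1 :: post)) A =
  (1 + beta * a) * H (map (phi e) (pre ++ (t + s).+1 :: post)) A +
  a * H (map (phi e) (pre ++ (t + s)%N :: post)) A.
Proof.
move=> ea hpre hpost; rewrite !map_cat /=.
rewrite part_factorS_swap part_factorS.
have -> : map (phi (swap_seq e t)) pre = map (phi e) pre.
  by apply/eq_in_map => l /hpre hl; apply: part_factor_swap; lia.
have -> : map (phi (swap_seq e t)) post = map (phi e) post.
  by apply/eq_in_map => l /hpost hl; apply: part_factor_swap; lia.
apply: cross_sum_prefix => B _; rewrite !cross_sum_cons !mulr_sumr -big_split /=.
apply: eq_bigr => i _; rewrite ea; move: (H _ _) => h.
by move: (phi _ _ _) (\prod_(j in _) _) => p q; rewrite /oplus; ring.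
Qed.

Hypotheses (x_inj : injective x) (x_unit : forall i, 1 + beta * x i != 0).
Hypothesis two_neq0 : 2%:R != 0 :> F.

Lemma cross_sum_swap_adjacent e t pre post A :
  {in pre, forall l, (t + s).+1 < l}%N -> {in post, forall l, l < t + s}%N ->
  let la := pre ++ (t + s).+1 :: (t + s)%N :: post in
  H (map (phi (swap_seq e t)) la) A = H (map (phi e) la) A.
Proof.
move=> hpre hpost la; rewrite /la !map_cat /=.
rewrite part_factorS_swap part_factorS part_factor_swap; last by lia.
have -> : map (phi (swap_seq e t)) pre = map (phi e) pre.
  by apply/eq_in_map => l /hpre hl; apply: part_factor_swap; lia.
have -> : map (phi (swap_seq e t)) post = map (phi e) post.
  by apply/eq_in_map => l /hpost hl; apply: part_factor_swap; lia.
apply: cross_sum_prefix_eq => B _.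
by rewrite (cross_sum_adjacent x_inj x_unit _ _ (e t)).
Qed.

End Exchange.

(** * Elimination of one variable *)

Section Reduction.
Variables (F : fieldType) (beta : F) (I : finType) (x : I -> F).
Hypotheses (x_inj : injective x) (x_unit : forall i, 1 + beta * x i != 0).
Variables (s : nat) (g0 : F -> F).
Local Notation "x ⊕ y" := (oplus beta x y) (at level 50, left associativity).
Local Notation "x ⊖ y" := (ominus beta x y) (at level 50, left associativity).
Local Notation H := (cross_sum_seq beta x).
Local Notation phi e := (part_factor beta s g0 e).
Implicit Types (e : nat -> F) (A : {set I}).

(** A part exceeding [s] contains y ⊖ x i0: it vanishes at x i0, and elsewhere it cancels the
    denominator of the cross factor with x i0, whose numerator y ⊕ x i0 acts as the new first
    parameter. *)
Lemma cross_sum_reduce_part e e' pre (tl tl1 tl2 : seq (F -> F)) (a c : F) i0 A :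
  e 0%N = 0 ⊖ x i0 -> e' 0%N = x i0 -> (forall j, e' j.+1 = e j.+1) ->
  i0 \in A -> {in pre, forall l, s < l}%N ->
  (forall B : {set I}, i0 \in B ->
     H tl B = a * H tl1 (B :\ i0) + c * H tl2 (B :\ i0)) ->
  H (map (phi e) pre ++ tl) A =
  a * H (map (phi e') pre ++ tl1) (A :\ i0) + c * H (map (phi e') pre ++ tl2) (A :\ i0).
Proof.
move=> e0 e'0 e'S iA hpre htl; apply: cross_sum_reduce => //.
  move=> l /hpre; rewrite -subn_gt0 /part_factor; case: (l - s)%N => // m _.
  by rewrite big_ord_recl e0 oplus_ominus // ominusxx mul0r mulr0.
move=> l i /hpre; rewrite -subn_gt0 /part_factor; case: (l - s)%N => // m _ ii0.
rewrite !big_ord_recl e0 e'0 oplus_ominus //.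
under [in RHS]eq_bigr do rewrite e'S.
have := xom_neq0 x_inj x_unit ii0.
set d := x i ⊖ x i0; set P := \prod_(j < m) _; set q := x i ⊕ x i0 => hd.
by field.
Qed.

Lemma cross_sum_reduce_parts e e' la i0 A :
  e 0%N = 0 ⊖ x i0 -> e' 0%N = x i0 -> (forall j, e' j.+1 = e j.+1) ->
  i0 \in A -> {in la, forall l, s < l}%N ->
  H (map (phi e) la) A = H (map (phi e') la) (A :\ i0).
Proof.
move=> e0 e'0 e'S iA hla; rewrite -[map _ _]cats0.
rewrite (@cross_sum_reduce_part e e' la [::] [::] [::] 1 0 i0) //.
  by rewrite cats0 mul1r mul0r addr0.
by move=> B _; rewrite mul1r mul0r addr0.
Qed.

(** In types B and C a part 1 consists of [g0] alone and can still use x i0. Splitting off u = g0 (x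
    i0) from the ⊕-sum of the [g0 (x i)] gives the recursion step for a diagonal box. *)
Lemma cross_sum_reduce_last e e' pre u i0 A : s = 1%N ->
  (forall B, H [:: g0] B = \big[oplus beta/0]_(i in B) g0 (x i)) -> u = g0 (x i0) ->
  e 0%N = 0 ⊖ x i0 -> e' 0%N = x i0 -> (forall j, e' j.+1 = e j.+1) ->
  i0 \in A -> {in pre, forall l, s < l}%N ->
  H (map (phi e) (pre ++ [:: 1%N])) A =
  (1 + beta * u) * H (map (phi e') (pre ++ [:: 1%N])) (A :\ i0) +
  u * H (map (phi e') pre) (A :\ i0).
Proof.
move=> s1 hg -> e0 e'0 e'S iA hpre; rewrite !map_cat -[map (phi e') pre in X in _ + X]cats0.
have phi1 e1 : map (phi e1) [:: 1%N] = [:: g0].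
  congr [:: _]; apply: funext => y.
  by rewrite /part_factor s1 subnn big_ord0 mulr1.
rewrite !phi1; apply: cross_sum_reduce_part => // B iB.
by rewrite !hg (big_setD1 i0) //= /oplus; ring.
Qed.

End Reduction.

(** * The first exchange in type D *)

Section TypeDExchange.
Variables (F : fieldType) (beta : F) (I : finType) (x : I -> F).
Hypotheses (x_inj : injective x) (x_unit : forall i, 1 + beta * x i != 0).
Local Notation "x ⊕ y" := (oplus beta x y) (at level 50, left associativity).
Local Notation H := (cross_sum_seq beta x).
Local Notation phi e := (part_factor beta 0 (fun=> 1) e).

(** By [one_part_sum] the first parameter matters to the final part 1 only if the number of
    variables left by [pre] is odd; [#|A| + size pre] has the same parity as that number. *)
Lemma cross_sum_swap_last e a (pre : seq nat) (A : {set I}) : e 1%N = e 0%N ⊕ a ->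
  {in pre, forall l, 1 < l}%N ->
  H (map (phi (swap_seq e 0)) (pre ++ [:: 1%N])) A =
  if odd (#|A| + size pre) then
    (1 + beta * a) * H (map (phi e) (pre ++ [:: 1%N])) A + a * H (map (phi e) pre) A
  else H (map (phi e) (pre ++ [:: 1%N])) A.
Proof.
move=> ea hpre; rewrite !map_cat -[map (phi e) pre in X in _ + X]cats0.
have -> : map (phi (swap_seq e 0)) pre = map (phi e) pre.
  by apply/eq_in_map => l /hpre hl; apply: part_factor_swap; lia.
have phi1 e1 (B : {set I}) : H (map (phi e1) [:: 1%N]) B =
    (if odd #|B| then e1 0%N else 0) ⊕ \big[oplus beta/0]_(i in B) x i.
  rewrite -one_part_sum // /=; apply: eq_bigr => i _.
  by rewrite /part_factor big_ord1 mulr1 mul1r.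
have oddB (B : {set I}) : (#|B| + size (map (phi e) pre) = #|A|)%N ->
    odd #|B| = odd (#|A| + size pre).
  by rewrite size_map => <-; rewrite !oddD addbK.
case: ifP => hodd.
  apply: cross_sum_prefix => B /oddB hB; rewrite !phi1 hB hodd /swap_seq /= ea.
  by rewrite /oplus; ring.
by apply: cross_sum_prefix_eq => B /oddB hB; rewrite !phi1 hB hodd.
Qed.

End TypeDExchange.

(** * Double induction on the number of variables and the position of the inserted inverse *)

Section Recursion.
Variables (F : fieldType) (beta : F) (N : nat) (x : 'I_N -> F) (z : nat -> F).
Variables (isD : bool) (g0 : F -> F) (w : nat -> nat -> F) (M : nat).
Hypotheses (x_inj : injective x) (x_unit : forall i, 1 + beta * x i != 0).
Hypothesis two_neq0 : 2%:R != 0 :> F.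
Hypotheses (zx : forall i : 'I_N, z i = x i) (M_gt0 : (0 < M)%N) (NM : (N <= M)%N).
Local Notation "x ⊕ y" := (oplus beta x y) (at level 50, left associativity).
Local Notation "x ⊖ y" := (ominus beta x y) (at level 50, left associativity).
Local Notation H := (cross_sum_seq beta x).
Local Notation s := (nat_of_bool (~~ isD)).
Local Notation phi e := (part_factor beta s g0 e).
Local Notation T n k la := (tableau_sum beta w isD M (partial_rows n k) (nth 0%N la)).
Hypothesis w_off : forall (n : 'I_N) k, isD || (0 < k)%N ->
  w n k = x n ⊕ z (n + k + isD)%N.
Hypothesis gD : isD -> g0 = fun=> 1.
Hypothesis wBC : forall n : 'I_N, ~~ isD -> w n 0%N = g0 (x n).
Hypothesis gBC : ~~ isD ->
  forall A : {set 'I_N}, H [:: g0] A = \big[oplus beta/0]_(i in A) g0 (x i).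

Let below n := [set i : 'I_N | (i < n)%N].
(* The parameters z_(n+1), z_(n+2), ... with [0 ⊖ x n] inserted at position [t]. *)
Let insert (n : 'I_N) t j : F :=
  if (j < t)%N then z (n + j).+1 else if j == t then 0 ⊖ x n else z (n + j)%N.

Let bounded la := all (leq^~ M) la && (size la <= M)%N.

Let T_nopart n k la : strict_partition la -> k.+1 \notin la -> T n k.+1 la = T n k la.
Proof.
move=> sla hk; apply: tableau_sum_noncorner; first exact: strict_partition_nth.
move=> p lp; case/negP: hk; rewrite -lp mem_nth // ltnNge.
by apply/negP => h; move: lp; rewrite nth_default.
Qed.

(** The box is blocked either by a next part equal to [k] or, on the diagonal in type D, by the
    parity of row [n]. *)
Let T_nocorner n k pre post : strict_partition (pre ++ k.+1 :: post) ->
  (size post = 0 -> isD && (k == 0) && (odd (size pre) != odd n))%N ->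
  ((0 < size post)%N -> (0 < k)%N && (nth 0 post 0 == k))%N ->
  T n k.+1 (pre ++ k.+1 :: post) = T n k (pre ++ k.+1 :: post).
Proof.
move=> sla h0 h1; apply: tableau_sum_noncorner; first exact: strict_partition_nth.
move=> p lp.
have -> : p = size pre.
  apply: (strict_shape_inj (strict_partition_nth sla)); first by rewrite lp.
  by rewrite lp nth_cat ltnn subnn.
rewrite nth_cat ltnNge leqW //= subSnn /= /parity_ok.
have [/h0/andP[-> /negbTE h] _|/h1/andP[k_gt0 /eqP ->]] := posnP (size post).
  by rewrite eq_sym h.
by rewrite leqNgt prednK // leqnn.
Qed.

Let T_corner n k pre post : strict_partition (pre ++ k.+1 :: post) ->
  bounded (pre ++ k.+1 :: post) -> (n <= M)%N -> parity_ok isD (size pre) k n ->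
  {in post, forall l, l < k}%N ->
  T n k.+1 (pre ++ k.+1 :: post) = (1 + beta * w n k) * T n k (pre ++ k.+1 :: post) +
     w n k * T n k (pre ++ k :: post).
Proof.
move=> sla /andP[hall hsz] nM pn hpost.
have kM : (k < M.+1)%N.
  by move: hall; rewrite all_cat => /andP[_ /=/andP[]]; lia.
have pM : (size pre < M.+1)%N by move: hsz; rewrite size_cat /=; lia.
rewrite (@tableau_sum_corner_step _ _ _ _ M n (Ordinal pM) (Ordinal kM)) //=.
- congr (_ + _ * tableau_sum _ _ _ _ _ _); apply: funext => q.
  rewrite !nth_cat; case: eqP => [->|/eqP qp]; first by rewrite ltnn subnn.
  case: ifP => // h; case E: (q - size pre)%N => [|m] //; lia.
- exact: strict_partition_nth.
- by rewrite nth_cat ltnn subnn.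
rewrite nth_cat ltnNge leqW //= subSnn /=.
case: post hpost {sla hall hsz} => // l post /(_ l); rewrite mem_head => /(_ isT) /=; lia.
Qed.

Let T_corner0 n pre : strict_partition (pre ++ [:: 1%N]) ->
  bounded (pre ++ [:: 1%N]) -> (n <= M)%N -> parity_ok isD (size pre) 0 n ->
  T n 1 (pre ++ [:: 1%N]) = (1 + beta * w n 0) * T n 0 (pre ++ [:: 1%N]) +
     w n 0 * T n 0 pre.
Proof.
move=> sla bla nM pn; rewrite T_corner //; congr (_ + _ * tableau_sum _ _ _ _ _ _).
(* Shapes are read through [nth 0], so a final part 0 is the same as no part. *)
apply: funext => q; rewrite nth_cat; case: ltnP => // h.
by rewrite [RHS]nth_default //; case: (q - _)%N => [|m] //=; rewrite nth_nil.
Qed.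

Let T_next n la : bounded la -> T n M la = T n.+1 0 la.
Proof.
move=> /andP[/allP hall _]; apply: eq_bigl => a; apply: asbool_equiv_eq.
have lM q : (nth 0 la q <= M)%N.
  have [h|h] := ltnP q (size la); last by rewrite nth_default.
  by apply: hall; exact: mem_nth.
by split=> h q d; have := h q d; case: ifP => // dq [-> h1 ->]; split=> //;
  move: h1; rewrite /partial_rows; have := lM q; lia.
Qed.

Let T_nil : T 0 0 [::] = 1.
Proof.
rewrite /tableau_sum (big_pred1 [ffun=> ord0]).
  by rewrite /shape_weight big1 // => q _; rewrite nth_nil big_ord0.
have e0 q d : @entry M [ffun=> ord0] q d = 0%N by rewrite /entry ffunE if_same.
move=> a; apply/asboolP/eqP => [h|-> q d]; last by rewrite nth_nil e0.
by apply: entry_inj => q d; have := h q d; rewrite nth_nil /= => ->; rewrite e0.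
Qed.

Let T_cons l la : strict_partition (l :: la) -> T 0 0 (l :: la) = 0.
Proof.
rewrite -[l :: la]cat0s strict_partition_cat => /and5P[_ _ l_gt0 _ _].
rewrite /tableau_sum big_pred0 // => a; apply/asboolP => h.
by have := h 0%N 0%N; rewrite /= l_gt0 /partial_rows => -[_ + _]; lia.
Qed.

Let insertS (n : 'I_N) t : insert n t.+1 = swap_seq (insert n t) t.
Proof.
apply: funext => j; rewrite /insert /swap_seq.
have [->|jt] := eqVneq j t; first by rewrite ltnSn ifN ?ifN ?addnS //; lia.
have [->|jt1] := eqVneq j t.+1; first by rewrite !ltnn eqxx.
by congr (if _ then _ else _); lia.
Qed.

Let insert_oplus (n : 'I_N) t :
  insert n t t.+1 = insert n t t ⊕ (x n ⊕ z (n + t).+1).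
Proof.
rewrite /insert ltnn eqxx ifN ?ifN ?addnS //; try lia.
by rewrite (oplusC beta (x n)) ominusK.
Qed.

Let below_setD (n : 'I_N) : below n.+1 :\ n = below n.
Proof. by apply/setP => i; rewrite !inE ltnS [RHS]ltn_neqAle. Qed.

Let mem_below (n : 'I_N) : n \in below n.+1.
Proof. by rewrite inE. Qed.

Let card_below n : (n <= N)%N -> #|below n| = n.
Proof.
elim: n => [|n IH] nN; first by apply: eq_card0 => i; rewrite inE.
by rewrite (cardsD1 (Ordinal nN)) mem_below (below_setD (Ordinal nN)) IH // ltnW.
Qed.

Let bounded_catl pre post : bounded (pre ++ post) -> bounded pre.
Proof.
by rewrite /bounded all_cat size_cat => /andP[/andP[-> _]]; lia.
Qed.

Let bounded_decr pre k post :
  bounded (pre ++ k.+1 :: post) -> bounded (pre ++ k :: post).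
Proof.
rewrite /bounded !all_cat !size_cat /= => /andP[/and3P[-> kM ->] ->].
by rewrite (ltnW kM).
Qed.

(** With [n] variables in use, the remaining ones come first among the parameters. *)
Let full n := forall la, strict_partition la -> bounded la ->
  H (map (phi (fun j => z (n + j)%N)) la) (below n) = T n 0 la.

(** Position [t] of the inverse matches content t + s, since content 0 belongs to [g0] in types B
    and C. *)
Let partial (n : 'I_N) t := forall la, strict_partition la -> bounded la ->
  H (map (phi (insert n t)) la) (below n.+1) = T n (t + s) la.

Let insert0_tail (n : 'I_N) j : z (n + j.+1)%N = insert n 0 j.+1.
Proof. by []. Qed.

Let partial0 (n : 'I_N) : full n -> partial n 0.
Proof.
move=> hn la sla bla; have la_gt0 l : l \in la -> (0 < l)%N.
  by move=> hl; rewrite lt0n; apply: contraTneq hl => ->; case/andP: sla.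
have zn : z (n + 0)%N = x n by rewrite addn0 zx.
have red la' : {in la', forall l, s < l}%N ->
    H (map (phi (insert n 0)) la') (below n.+1) =
    H (map (phi (fun j => z (n + j)%N)) la') (below n).
  move=> hla'; rewrite -below_setD.
  by apply: cross_sum_reduce_parts.
have [D|BC] : isD \/ ~~ isD by exact/orP/orbN.
  by rewrite red ?hn ?D // => l /la_gt0; rewrite D.
have s1 : s = 1%N by rewrite BC.
have s01 : (0 + s)%N = 1%N := s1.
rewrite s01; case: (cornerP 0 sla) => [h1|//|pre post Ela hpre _ _ /(_ erefl)[Ep spre]].
  rewrite red ?hn ?T_nopart // => l hl; rewrite s1 ltn_neqAle la_gt0 // andbT eq_sym.
  by apply: contraNneq h1 => <-.
rewrite Ep in Ela; rewrite Ela in sla bla *.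
rewrite T_corner0 //; last 2 first.
- by apply: leq_trans NM; exact: ltnW.
- by rewrite /parity_ok (negbTE BC).
rewrite -hn // -hn ?(bounded_catl bla) // -below_setD.
apply: (cross_sum_reduce_last x_inj x_unit s1 _ _ _ zn (insert0_tail n)) => //.
- exact: gBC.
- exact: wBC.
- by rewrite s1.
Qed.

Let partialS (n : 'I_N) t : (t + s < M)%N -> partial n t -> partial n t.+1.
Proof.
move=> tM hn la sla bla; rewrite addSn insertS.
have nM : (n <= M)%N by apply: leq_trans NM; exact: ltnW.
(* The offsets [s] and [isD] add up to 1 in every type, so [w n (t + s)] involves precisely the
   parameter being exchanged. *)
have insE : insert n t t.+1 = insert n t t ⊕ w n (t + s).
  rewrite insert_oplus w_off; last by case: (isD); rewrite ?addn1.
  by congr (_ ⊕ (_ ⊕ z _)); case: (isD); rewrite /= ?addn0 ?addn1 ?addnS.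
case: (cornerP (t + s) sla) => [hk|pre post k_gt0 Ela hpre hpost|
                                pre post Ela hpre hpost hs h0].
- by rewrite cross_sum_swap_nopart // T_nopart // hn.
- rewrite Ela in sla bla *.
  by rewrite cross_sum_swap_adjacent // T_nocorner ?hn // k_gt0 eqxx.
rewrite Ela in sla bla *.
have [k0|k_gt0] := posnP (t + s); last first.
  rewrite (cross_sum_swap_corner _ _ _ insE) // T_corner //; last first.
    by rewrite /parity_ok (gtn_eqF k_gt0) andbF.
  by rewrite !hn ?hs ?(bounded_decr bla).
have [Ep spre] := h0 k0.
have D : isD by move: k0; case: (isD) => //=; rewrite addn1.
have t0 : t = 0%N by move: k0; lia.
rewrite {}Ep k0 in sla bla *; rewrite k0 in insE hpre.
have hn' := hn _ sla bla; have hnp := hn _ spre (bounded_catl bla).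
have phiD e : phi e = part_factor beta 0 (fun=> 1) e by rewrite gD // D.
rewrite k0 t0 phiD in hn' hnp; rewrite t0 in insE; rewrite t0 phiD.
rewrite (cross_sum_swap_last x_inj x_unit _ insE) // card_below // hn' hnp.
(* There are n + 1 variables, so the sum with [size pre] is odd exactly when [n] has the parity of
   the row [size pre] of the diagonal box. *)
case: ifP => hodd.
  rewrite T_corner0 // /parity_ok D /=.
  by move: hodd; rewrite addSn /= oddD; case: (odd n); case: (odd _).
rewrite T_nocorner // => _; rewrite D /=.
by move: hodd; rewrite addSn /= oddD; case: (odd n); case: (odd _).
Qed.

Let fullS (n : 'I_N) : full n -> full n.+1.
Proof.
move=> hn la sla bla; have sM : (s <= M)%N by case: (isD).
have part t : (t + s <= M)%N -> partial n t.
  elim: t => [|t IH] tM; first exact: partial0.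
  by apply: partialS => //; apply: IH; exact: ltnW.
rewrite -T_next //.
(* A part of size at most [M] uses at most M - s parameters, so it never reaches an inverse inserted
   at position M - s. *)
have -> : T n M la = T n (M - s + s) la by rewrite subnK.
rewrite -part ?subnK //.
congr (H _ _); apply/eq_in_map => l ll; apply: funext => y.
rewrite /part_factor; congr (_ * _); apply: eq_bigr => j _.
rewrite /insert ifT ?addSn //; apply: leq_trans (ltn_ord j) _.
by apply: leq_sub2r; case/andP: bla => /allP /(_ l ll).
Qed.

Theorem cross_sum_tableau_sum la : strict_partition la -> bounded la ->
  H (map (phi (fun j => z (N + j)%N)) la) [set: 'I_N] = T N 0 la.
Proof.
have all_full n : (n <= N)%N -> full n.
  elim: n => [|n IH] nN; last by apply: (fullS (n := Ordinal nN)); apply: IH; exact: ltnW.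
  case=> [|l la'] sla bla; first by rewrite T_nil.
  by rewrite T_cons //= big_pred0 // => i; rewrite inE.
move=> sla bla; rewrite -all_full //; congr (H _ _).
by apply/setP => i; rewrite !inE ltn_ord.
Qed.

End Recursion.

(** * Excited diagrams as fillings *)

Definition is_typeD (X : lie_type) : bool := if X is TypeD then true else false.

Section Diagrams.
Variables (X : lie_type) (n : nat) (la : seq nat).
Hypothesis la_strict : strict_partition la.
Local Notation L := (nth 0%N la).
Local Notation isD := (is_typeD X).
Local Notation tab := (tableau isD (fun=> n) L).
Implicit Types (f g : nat -> nat -> nat) (D : diagram).

Let L_strict : strict_shape L := strict_partition_nth la_strict.

Definition boxes : seq (nat * nat) :=
  [seq (q, d) | q <- iota 0 (size la), d <- iota 0 (L q)].

Definition place f (c : nat * nat) : nat * nat :=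
  ((f c.1 c.2).+1, (f c.1 c.2).+1 + c.2)%N.

Definition diagram_of f : diagram := [fset c in map (place f) boxes]%fset.

Lemma mem_boxes q d : ((q, d) \in boxes) = (d < L q)%N.
Proof.
apply/allpairsPdep/idP => [[q' [d' [_ + [-> ->]]]]|dq]; first by rewrite mem_iota.
exists q, d; rewrite !mem_iota; split=> //=.
by rewrite ltnNge; apply/negP => h; rewrite nth_default in dq.
Qed.

Lemma boxes_uniq : uniq boxes.
Proof.
by apply: allpairs_uniq_dep => [|q _|[q d] [q' d'] _ _ [-> ->]//]; exact: iota_uniq.
Qed.

Lemma mem_diagram_of f i j :
  reflect (exists q d, [/\ (d < L q)%N, i = (f q d).+1 & j = (i + d)%N])
          ((i, j) \in diagram_of f).
Proof.
rewrite inE /=; apply: (iffP mapP) => [[[q d] + [-> ->]]|[q [d [dq -> ->]]]].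
  by rewrite mem_boxes => dq; exists q, d.
by exists (q, d); rewrite ?mem_boxes.
Qed.

Section TableauFacts.
Variable f : nat -> nat -> nat.
Hypothesis ft : tab f.

Lemma tableau_box q d : (d < L q)%N ->
  [/\ (lower_bound f q d <= f q d)%N, (f q d < n)%N & parity_ok isD q d (f q d)].
Proof. by move=> dq; have := ft q d; rewrite dq. Qed.

Lemma tableau_row q d : (d.+1 < L q)%N -> (f q d <= f q d.+1)%N.
Proof. by move=> /tableau_box[+ _ _]; rewrite /lower_bound geq_max => /andP[]. Qed.

Lemma tableau_col q d : (d < L q.+1)%N -> (f q d.+1 < f q.+1 d)%N.
Proof. by move=> /tableau_box[+ _ _]; rewrite /lower_bound geq_max => /andP[]. Qed.

(** Going right and then down-left, (q, d), (q, d + 1), (q + 1, d), gives a weak and then a strict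
    increase; boxes of equal content therefore never collide. *)
Lemma tableau_diag q q' d : (q < q')%N -> (d < L q')%N -> (f q d < f q' d)%N.
Proof.
elim: q' => // q' IH; rewrite ltnS leq_eqVlt => /predU1P[->|qq'] dq.
  apply: leq_ltn_trans (tableau_col dq); apply: tableau_row.
  by have := L_strict q'; lia.
apply: leq_ltn_trans (tableau_col dq); apply: leq_trans (tableau_row _).
  by apply: ltnW; apply: IH => //; have := L_strict q'; lia.
by have := L_strict q'; lia.
Qed.

Lemma tableau_diag_le q q' d : (q <= q')%N -> (d < L q')%N -> (f q d <= f q' d)%N.
Proof. by rewrite leq_eqVlt => /predU1P[->//|h] hd; apply/ltnW/tableau_diag. Qed.

Lemma tableau_ge q d : (d < L q)%N -> (q <= f q d)%N.
Proof.
elim: q d => // q IH d dq; apply: leq_ltn_trans (tableau_col dq); apply: IH.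
by have := L_strict q; lia.
Qed.

Lemma tableau_off q d : (L q <= d)%N -> f q d = 0%N.
Proof. by rewrite leqNgt => /negbTE dq; have := ft q d; rewrite dq. Qed.

End TableauFacts.

Lemma place_inj f : tab f -> {in boxes &, injective (place f)}.
Proof.
move=> ft [q d] [q' d']; rewrite !mem_boxes /place /= => dq dq' [e1 e2].
have e : d = d' by lia.
rewrite -{}e in dq' e1 *; congr (_, _).
case: (ltngtP q q') => // h.
  by have := tableau_diag ft h dq'; lia.
by have := tableau_diag ft h dq; lia.
Qed.

(** Boxes keep their order along each diagonal, so the diagram tells which box sits where; by
    induction on the row, the box found at a given place cannot come from an earlier row. *)
Lemma diagram_of_inj f g : tab f -> tab g -> diagram_of f = diagram_of g -> f = g.
Proof.
move=> ft gt e; apply: funext => q; elim/ltn_ind: q => q IH.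
apply: funext => d; have [Ld|dq] := leqP (L q) d; first by rewrite !tableau_off.
have key f' g' : tab f' -> tab g' -> diagram_of f' = diagram_of g' ->
    (forall q', (q' < q)%N -> f' q' = g' q') -> (g' q d <= f' q d)%N.
  move=> ft' gt' e' IH'.
  have : ((f' q d).+1, (f' q d).+1 + d)%N \in diagram_of f'.
    by apply/mem_diagram_of; exists q, d.
  rewrite e' => /mem_diagram_of[q' [d' [dq' [e1] e2]]].
  have ed : d = d' by lia.
  rewrite -ed in dq' e1; rewrite e1.
  have [q'q|qq'] := ltnP q' q; last exact: tableau_diag_le.
  by have := tableau_diag ft' q'q dq; rewrite IH'; lia.
apply/eqP; rewrite eqn_leq !key // => q' /IH; by [].
Qed.

Definition update f q d t q' d' : nat := if (q' == q) && (d' == d) then t else f q' d'.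

Lemma diagram_of_update f q d t : tab f -> (d < L q)%N ->
  diagram_of (update f q d t) =
  move_box (diagram_of f) (place f (q, d)) (t.+1, t.+1 + d)%N.
Proof.
move=> ft dq; apply/fsetP => -[i j]; rewrite /move_box in_fset1U in_fsetD1.
apply/mem_diagram_of/orP => [[q' [d' [dq']]]|].
  rewrite /update; case: ifP => [/andP[_ /eqP ->] -> ->|h -> ->].
    by left; rewrite eqxx.
  right; apply/andP; split; last by apply/mem_diagram_of; exists q', d'.
  apply: contraFneq h => e.
  have [-> ->] : (q', d') = (q, d) by apply: (place_inj ft); rewrite ?mem_boxes.
  by rewrite !eqxx.
case=> [/eqP[-> ->]|/andP[ne /mem_diagram_of[q' [d' [dq' ei ej]]]]].
  by exists q, d; rewrite /update !eqxx.
exists q', d'; split=> //; rewrite /update ifN //.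
by apply: contraNN ne => /andP[/eqP <- /eqP <-]; rewrite /place /= ej ei.
Qed.

Lemma tableau_update f q d t : tab f -> (d < L q)%N ->
  (lower_bound f q d <= t < n)%N -> parity_ok isD q d t ->
  ((d.+1 < L q)%N -> (t <= f q d.+1)%N) ->
  (forall d', d = d'.+1 -> (d' < L q.+1)%N -> (t < f q.+1 d')%N) ->
  tab (update f q d t).
Proof.
move=> ft dq /andP[lt tn] pt right down q' d'; have := ft q' d'.
case: ifP => [dq' [h1 h2 h3]|dq' h0]; last first.
  by rewrite /update; case: ifP => // /andP[/eqP e1 /eqP e2]; rewrite e1 e2 dq in dq'.
have [/andP[/eqP e1 /eqP e2]|ne] := boolP ((q' == q) && (d' == d)).
  rewrite e1 e2 {2 3 4}/update !eqxx; split=> //.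
  suff -> : lower_bound (update f q d t) q d = lower_bound f q d by [].
  rewrite /lower_bound /update; congr maxn.
    by case: (d) => // d''; rewrite ifN // negb_and; apply/orP; right; lia.
  by case: (q) => // q''; rewrite ifN // negb_and; apply/orP; left; lia.
rewrite {2 3 4}/update (negbTE ne); split=> //.
move: h1; rewrite /lower_bound !geq_max => /andP[l u]; apply/andP; split.
  case: d' l dq' {h2 h3 ne u} => // d' l dq'; rewrite /update.
  by case: ifP => // /andP[/eqP e1 /eqP e2]; rewrite e1 e2 in dq' *; exact: right.
case: q' u dq' {h2 h3 ne l} => // q' u dq'; rewrite /update.
case: ifP => // /andP[/eqP e1 /eqP e2]; rewrite e1 in dq' *.
by apply: down.
Qed.

Lemma notin_diagram_of f q d i j : (i, j) \notin diagram_of f -> (d < L q)%N ->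
  i = (f q d).+1 -> j <> (i + d)%N.
Proof. by move=> h dq ei ej; case/mem_diagram_of: h; exists q, d. Qed.

Definition excitation_step : diagram -> diagram -> Prop :=
  match X with TypeB | TypeC => exciteI n | TypeD => exciteII n end.

Lemma ordinary_excitation f i j : tab f -> isD ==> (i != j) ->
  excitable (diagram_of f) i j -> region n (i.+1, j.+1) ->
  exists2 f', tab f' & move_box (diagram_of f) (i, j) (i.+1, j.+1) = diagram_of f'.
Proof.
move=> ft hD [/mem_diagram_of[q [d [dq ei ej]]] h1 _ h3] /andP[/andP[_ /= hn] _].
have [l u p] := tableau_box ft dq.
exists (update f q d (f q d).+1); last first.
  by rewrite diagram_of_update // /place /= ej ei !addSn.
apply: tableau_update => //.
- by rewrite (leq_trans l) //=; lia.
- apply/implyP => /andP[D /eqP d0]; move: hD; rewrite D ej d0; lia.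
- move=> dq1; rewrite ltn_neqAle (tableau_row ft) // andbT; apply/eqP => e.
  by case: (notin_diagram_of h3 dq1); lia.
move=> d' ed dq1; rewrite ltn_neqAle {2}ed (tableau_col ft) // andbT.
apply/eqP => e; have ij : i <> j by lia.
by case: (notin_diagram_of (h1 ij) dq1); lia.
Qed.

Lemma diagonal_excitation f i : tab f -> isD -> (i, i) \in diagram_of f ->
  (i, i.+1) \notin diagram_of f -> (i.+1, i.+2) \notin diagram_of f ->
  region n (i.+2, i.+2) ->
  exists2 f', tab f' & move_box (diagram_of f) (i, i) (i.+2, i.+2) = diagram_of f'.
Proof.
move=> ft D /mem_diagram_of[q [d [dq ei ej]]] h1 h2 /andP[/andP[_ /= hn] _].
have d0 : d = 0%N by lia.
subst d; have [l u p] := tableau_box ft dq.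
exists (update f q 0%N (f q 0%N).+2); last first.
  by rewrite diagram_of_update // /place /= !addSn !addn0 ei.
apply: tableau_update => //.
- by rewrite (leq_trans l) //=; lia.
- by move: p; rewrite /parity_ok D /= negbK.
move=> dq1; have := tableau_row ft dq1.
have /eqP n1 : f q 0%N != f q 1%N.
  by apply/eqP => e; case: (notin_diagram_of h1 dq1); lia.
have /eqP n2 : (f q 0%N).+1 != f q 1%N.
  by apply/eqP => e; case: (notin_diagram_of h2 dq1); lia.
by lia.
Qed.

Lemma excitation_step_tableau f D' : tab f -> excitation_step (diagram_of f) D' ->
  exists2 f', tab f' & D' = diagram_of f'.
Proof.
move=> ft; have [[D ->]|[D ->]] : isD = false /\ excitation_step = exciteI n \/
    isD /\ excitation_step = exciteII n.
- by rewrite /excitation_step; case: (X); [left|left|right].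
- case=> [i [j [h1 h2 ->]]].
  have [|f' ft' e] := ordinary_excitation ft _ h1 h2; first by rewrite D.
  by exists f'.
case=> [[i [j [/eqP ij h1 h2 ->]]]|[i [h1 [h2 h3 h4 h5] h6 ->]]].
  have [|f' ft' e] := ordinary_excitation ft _ h1 h2; first by apply/implyP.
  by exists f'.
have [f' ft' e] := diagonal_excitation ft D h1 h2 h4 h6.
by exists f'.
Qed.

Definition ground (q d : nat) : nat := if (d < L q)%N then q else 0%N.

Lemma diagram_of_ground : diagram_of ground = shifted_diagram la.
Proof.
apply/fsetP => -[i j]; apply/mem_diagram_of/idP.
  case=> q [d [dq -> ->]]; rewrite /ground dq inE /=.
  apply/allpairsPdep; exists q.+1, (q.+1 + d)%N; rewrite !mem_iota /=.
  split=> //; last by lia.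
  by rewrite add1n ltnS ltnNge; apply/negP => h; rewrite nth_default in dq.
rewrite inE /= => /allpairsPdep[q [d [+ + [-> ->]]]]; rewrite !mem_iota => hq hd.
exists q.-1, (d - q)%N; have dq : (d - q < L q.-1)%N by lia.
by split=> //; rewrite /ground ?dq; lia.
Qed.

Lemma ground_tableau : (size la <= n)%N -> tab ground.
Proof.
move=> hn q d; case: ifP => dq; last by rewrite /ground dq.
have sq : (q < size la)%N.
  by rewrite ltnNge; apply/negP => h; rewrite nth_default in dq.
rewrite /ground dq; split; [|lia|by rewrite /parity_ok eqxx implybT].
rewrite /lower_bound geq_max; apply/andP; split.
  by case: d dq => // d dq; case: ifP.
by case: q dq sq => // q dq sq; case: ifP.
Qed.

Lemma notin_diagram_ofI f u e :
  (forall q, (e < L q)%N -> f q e != u) -> (u.+1, u.+1 + e)%N \notin diagram_of f.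
Proof.
move=> h; apply/negP => /mem_diagram_of[q [d [dq e1 e2]]].
have ed : d = e by lia.
by have := h q; rewrite -ed dq => /(_ isT); lia.
Qed.

(* The first displaced box in reading order can be moved back: the boxes on its
   left and above it are at their initial place. *)
Lemma unexcite f : tab f -> (exists q d, (d < L q)%N && (f q d != q)) ->
  exists q d v, let f' := update f q d v in
    [/\ (d < L q)%N, (v < f q d)%N, tab f' &
        excitation_step (diagram_of f') (diagram_of f)].
Proof.
move=> ft hex.
have [q hq qmin] : exists2 q, exists d, (d < L q)%N && (f q d != q) &
    forall q' d', (q' < q)%N -> (d' < L q')%N -> f q' d' = q'.
  have hP : exists q, has (fun d => f q d != q) (iota 0 (L q)).
    case: hex => q [d /andP[dq hf]]; exists q; apply/hasP; exists d => //.
    by rewrite mem_iota.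
  case: (ex_minnP hP) => q /hasP[d hd hf] hmin; exists q.
    by exists d; rewrite hf andbT; move: hd; rewrite mem_iota.
  move=> q' d' q'q dq'; apply/eqP; apply: contraTT q'q => hf'; rewrite -leqNgt.
  by apply: hmin; apply/hasP; exists d' => //; rewrite mem_iota.
case: (ex_minnP hq) => d /andP[dq fq] dmin'.
have dmin d' : (d' < d)%N -> f q d' = q.
  move=> d'd; apply/eqP; apply: contraTT (d'd) => hf; rewrite -leqNgt.
  by apply: dmin'; rewrite hf (ltn_trans d'd dq).
have qf : (q < f q d)%N by rewrite ltn_neqAle eq_sym fq (tableau_ge ft dq).
have [lf fn pf] := tableau_box ft dq.
(* In type D a diagonal box goes back two rows; its row exceeds [q] and has the parity of [q], so
   the target is still at least [q]. *)
pose dbl := isD && (d == 0%N); pose v := (f q d - dbl.+1)%N.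
have qv : (q <= v)%N.
  rewrite /v; move: pf; rewrite /parity_ok -/dbl; case: (dbl); last by lia.
  by move=> /= /eqP e; have : odd (f q d) = odd q := e; lia.
have fv : f q d = (v + dbl.+1)%N.
  rewrite /v; move: pf; rewrite /parity_ok -/dbl; case: (dbl); last by lia.
  by move=> /= /eqP e; have : odd (f q d) = odd q := e; lia.
have vf : (v < f q d)%N by lia.
have lq : (lower_bound f q d <= q)%N.
  rewrite /lower_bound geq_max; apply/andP; split.
    by case Ed: (d) => [//|d']; rewrite dmin // Ed.
  case Eq: (q) => [//|q']; rewrite qmin ?Eq //.
  by have := L_strict q'; rewrite -Eq; lia.
have pv : parity_ok isD q d v.
  move: pf; rewrite /parity_ok -/dbl /v; case: (dbl) => //= /eqP e.
  by apply/eqP; have : odd (f q d) = odd q := e; lia.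
exists q, d, v => f'.
have ft' : tab f'.
  apply: tableau_update => //.
  - by rewrite (leq_trans lq) //=; lia.
  - by move=> dq1; rewrite (leq_trans (ltnW vf)) ?(tableau_row ft).
  move=> d' ed dq1; apply: ltn_trans vf _; rewrite ed; exact: (tableau_col ft).
split=> //.
have f'qd : f' q d = v by rewrite /f' /update !eqxx.
have f'E q' d' : (q' != q) || (d' != d) -> f' q' d' = f q' d'.
  by rewrite /f' /update -negb_and => /negbTE ->.
have ff' : f = update f' q d (f q d).
  apply: funext => q'; apply: funext => d'; rewrite /f' /update.
  by case: ifP => [/andP[/eqP -> /eqP ->]|->].
have mem : (v.+1, v.+1 + d)%N \in diagram_of f'.
  by apply/mem_diagram_of; exists q, d; rewrite f'qd.
have same u : (v < u <= f q d)%N -> (u.+1, u.+1 + d)%N \notin diagram_of f'.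
  move=> hu; apply: notin_diagram_ofI => q' dq'; case: (ltngtP q' q) => [h|h|->].
  - by rewrite f'E ?(ltn_eqF h) // qmin //; lia.
  - by rewrite f'E ?(gtn_eqF h) //; have := tableau_diag ft h dq'; lia.
  - by rewrite f'qd; lia.
have right u : (v <= u < f q d)%N -> (u.+1, u.+1 + d.+1)%N \notin diagram_of f'.
  move=> hu; apply: notin_diagram_ofI => q' dq'; have [h|h] := ltnP q' q.
    by rewrite f'E ?(ltn_eqF h) // qmin //; lia.
  rewrite f'E; last by apply/orP; right; lia.
  have := tableau_diag_le ft h dq'.
  have dq1 : (d.+1 < L q)%N.
    by move: h; rewrite leq_eqVlt => /predU1P[->//|/(strict_shape_lt L_strict)]; lia.
  by have := tableau_row ft dq1; lia.
have below u d' : d = d'.+1 -> (v <= u < f q d)%N ->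
    (u.+2, u.+2 + d')%N \notin diagram_of f'.
  move=> ed hu; apply: notin_diagram_ofI => q' dq'.
  rewrite f'E; last by apply/orP; right; lia.
  case: (ltngtP q' q) => [h|h|->]; first by rewrite qmin //; lia.
    have := tableau_diag_le ft h dq'.
    have dq1 : (d' < L q.+1)%N.
      by move: h; rewrite leq_eqVlt => /predU1P[->//|/(strict_shape_lt L_strict)]; lia.
    by have := tableau_col ft dq1; rewrite -ed; lia.
  by rewrite dmin; lia.
have stepE : diagram_of f =
    move_box (diagram_of f') (v.+1, v.+1 + d)%N ((f q d).+1, (f q d).+1 + d)%N.
  by rewrite {1}ff' diagram_of_update // /place /= f'qd.
rewrite stepE.
have ord : dbl = false -> [/\ excitable (diagram_of f') v.+1 (v.+1 + d),
     region n (v.+2, (v.+1 + d).+1)%N &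
     move_box (diagram_of f') (v.+1, v.+1 + d)%N ((f q d).+1, (f q d).+1 + d)%N =
     move_box (diagram_of f') (v.+1, v.+1 + d)%N (v.+2, (v.+1 + d).+1)%N].
  move=> hdbl; have vS : f q d = v.+1 by rewrite fv hdbl addn1.
  split; last by rewrite vS addSn.
  - split=> //.
    + case ed : d => [|d'] hv; first by rewrite addn0 in hv.
      have hu : (v <= v < f q d)%N by lia.
      by have := below _ _ ed hu; rewrite addSn addnS.
    + have hu : (v < v.+1 <= f q d)%N by lia.
      by have := same _ hu; rewrite addSn.
    + have hu : (v <= v < f q d)%N by lia.
      by have := right _ hu; rewrite addnS.
  - by apply/andP; split=> /=; lia.
have [[D ->]|[D ->]] : isD = false /\ excitation_step = exciteI n \/
    isD /\ excitation_step = exciteII n.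
- by rewrite /excitation_step; case: (X); [left|left|right].
- by exists v.+1, (v.+1 + d)%N; apply: ord; rewrite /dbl D.
have [d0|d0] := eqVneq d 0%N; last first.
  left; exists v.+1, (v.+1 + d)%N.
  by have [|h1 h2 h3] := ord; [rewrite /dbl (negbTE d0) andbF|split=> //; lia].
right; subst d.
have vS : f q 0%N = v.+2 by rewrite fv /dbl D /= addn2.
exists v.+1; rewrite vS !addn0; rewrite addn0 in mem.
split=> //.
- have r u : (v <= u < v.+2)%N -> (u.+1, u.+2)%N \notin diagram_of f'.
    by rewrite -vS => /right; rewrite addnS addn0.
  have m u : (v < u <= v.+2)%N -> (u.+1, u.+1)%N \notin diagram_of f'.
    by rewrite -vS => /same; rewrite addn0.
  by split; [apply: r|apply: m|apply: r|apply: m]; lia.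
by apply/andP; split=> /=; lia.
Qed.

(** Induction on the sum of the entries, which moving a box back lowers; with no displaced box the
    filling is [ground]. *)
Lemma excited_tableau f : tab f ->
  clos_refl_trans diagram excitation_step (shifted_diagram la) (diagram_of f).
Proof.
move En : (\sum_(c <- boxes) f c.1 c.2)%N => k; elim/ltn_ind: k f En => k IH f En ft.
have [hex|nhex] := pselect (exists q d, (d < L q)%N && (f q d != q)).
  have [q [d [v [dq vf ft' hs]]]] := unexcite ft hex.
  apply: rt_trans (rt_step _ _ _ _ hs); apply: IH (erefl _) ft'.
  rewrite -En (bigD1_seq (q, d)) ?mem_boxes ?boxes_uniq //=.
  rewrite [X in (_ < X)%N](bigD1_seq (q, d)) ?mem_boxes ?boxes_uniq //=.
  rewrite {1}/update !eqxx -addSn leq_add // leq_eqVlt; apply/orP; left; apply/eqP.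
  apply: eq_bigr => -[q' d']; rewrite xpair_eqE /update /= => /negbTE ->; by [].
suff -> : f = ground by rewrite diagram_of_ground; exact: rt_refl.
apply: funext => q; apply: funext => d; rewrite /ground; have := ft q d.
case: ifP => // dq _; apply/eqP/negPn/negP => h; apply: nhex.
by exists q, d; rewrite dq.
Qed.

Lemma excitedE : (size la <= n)%N -> excited X n la = (diagram_of @` [set f | tab f])%classic.
Proof.
move=> hn; apply/seteqP; split=> [D /= hD|_ [f ft <-]]; last exact: excited_tableau.
suff key D0 D' : clos_refl_trans diagram excitation_step D0 D' ->
    (exists2 f, tab f & D0 = diagram_of f) -> exists2 f, tab f & D' = diagram_of f.
  have [|f ft ->] := key _ _ hD; last by exists f.
  by exists ground; [exact: ground_tableau|rewrite diagram_of_ground].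
elim=> [D1 D2 hs [f ft e]|//|D1 D2 D3 _ h1 _ h2 /h1/h2 //].
by rewrite e in hs; exact: excitation_step_tableau hs.
Qed.

Lemma prod_diagram_of (R : comNzRingType) (G : nat * nat -> R) f : tab f ->
  \prod_(c <- diagram_of f) G c = \prod_(c <- boxes) G (place f c).
Proof.
move=> ft; rewrite -(big_map (place f) xpredT); apply: perm_big.
apply: uniq_perm; first exact: fset_uniq.
  by rewrite map_inj_in_uniq ?boxes_uniq //; exact: place_inj.
by move=> c; rewrite [LHS]in_fset.
Qed.

Definition free_rows f (c : nat * nat) : seq nat :=
  [seq m <- index_iota (lower_bound f c.1 c.2) (f c.1 c.2) | parity_ok isD c.1 c.2 m].

Definition back_seq f : seq (nat * nat) :=
  [seq (m.+1, m.+1 + c.2)%N | c <- boxes, m <- free_rows f c].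

Lemma mem_back_seq f i j :
  reflect (exists q d m, [/\ (d < L q)%N, (lower_bound f q d <= m < f q d)%N,
             parity_ok isD q d m, i = m.+1 & j = (m.+1 + d)%N])
          ((i, j) \in back_seq f).
Proof.
apply: (iffP allpairsPdep) => [[[q d] [m [+ + [-> ->]]]]|[q [d [m [dq hm pm -> ->]]]]].
  rewrite mem_boxes mem_filter mem_index_iota /= => dq /andP[pm hm].
  by exists q, d, m.
by exists (q, d), m; rewrite mem_boxes mem_filter mem_index_iota pm.
Qed.

(** * Back boxes as free rows *)

Section BackBoxes.
Variable f : nat -> nat -> nat.
Hypothesis ft : tab f.

(** Boxes of earlier rows on the same or the next diagonal stay out of the free rows of (q, d); in
    particular the free rows of distinct boxes on a diagonal are disjoint. *)
Lemma diag_lower_bound q q' d : (q' < q)%N -> (d < L q)%N ->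
  (f q' d < lower_bound f q d)%N /\ (f q' d.+1 < lower_bound f q d)%N.
Proof.
case: q => // q; rewrite ltnS => qq' dq.
have dq1 : (d.+1 < L q)%N by have := L_strict q; lia.
have h : (f q d.+1 < lower_bound f q.+1 d)%N by rewrite /lower_bound leq_maxr.
split; apply: leq_ltn_trans h; last exact: tableau_diag_le.
apply: leq_trans (tableau_row ft dq1); apply: tableau_diag_le => //; exact: ltnW.
Qed.

Lemma back_seq_uniq : uniq (back_seq f).
Proof.
apply: allpairs_uniq_dep => [|c _|]; first exact: boxes_uniq.
  by rewrite filter_uniq // iota_uniq.
have mem (p : {_ : nat * nat & nat}) :
    p \in [seq existT (fun=> nat) c m | c <- boxes, m <- free_rows f c] ->
    ((tag p).2 < L (tag p).1)%N /\
    (lower_bound f (tag p).1 (tag p).2 <= tagged p < f (tag p).1 (tag p).2)%N.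
  case/allpairsPdep => c [m [hc hm ->]] /=; move: hc hm.
  rewrite {1}[c]surjective_pairing mem_boxes mem_filter mem_index_iota.
  by move=> dq /andP[_ hm]; exact: (conj dq hm).
move=> [[q d] m] [[q' d'] m'] /mem[/= dq hm] /mem[/= dq' hm'] /= [em ed].
have {}ed : d = d' by lia.
move: em => em; subst m'; subst d'.
suff -> : q = q' by [].
case: (ltngtP q q') => // h.
  by have [] := diag_lower_bound h dq'; lia.
by have [] := diag_lower_bound h dq; lia.
Qed.

(** The upper neighbour in the shape has content d + 1 and would be met on the right of the sliding
    box, the left neighbour has content d - 1 and would be met below it. Avoiding both is the
    condition that the target row is at least [lower_bound]. *)
Lemma back_boxesE : back_boxes X n (diagram_of f) = [set` back_seq f]%classic.
Proof.
apply/seteqP; split=> -[i j] /=.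
  case=> /andP[/andP[/= i_gt0 _] ij] _ [k [k_gt0 hD _ hr hd] hk].
  case/mem_diagram_of: hD => q [d [dq e1 e2]].
  apply/mem_back_seq; exists q, d, (f q d - k)%N.
  have fk : f q d = (i.-1 + k)%N by lia.
  split=> //; try lia; last first.
    apply/implyP => /andP[D /eqP d0].
    have [_ _ ] := tableau_box ft dq; rewrite /parity_ok D d0 /= => /eqP p.
    have XD : X = TypeD by move: D; case: (X).
    have ij' : i = j by lia.
    have := hk XD ij'; rewrite d0 in fk p *; apply/contraNeq; lia.
  rewrite /lower_bound geq_max -andbA; apply/and3P; split; last by lia.
    case Ed: (d) => [//|d']; rewrite leqNgt; apply/negP => h.
    have ij' : i <> j by lia.
    have dq' : (d'.+1 < L q)%N by rewrite -Ed.
    have := tableau_row ft dq'; rewrite -Ed => hle.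
    rewrite -Ed in h; have hs : (f q d' - i.-1 - 1 < k)%N by lia.
    by case/negP: (hd ij' _ hs); apply/mem_diagram_of; exists q, d'; split; lia.
  case Eq: (q) => [//|q']; rewrite leqNgt -Eq; apply/negP => h.
  have dq' : (d < L q'.+1)%N by rewrite -Eq.
  have := tableau_col ft dq'; rewrite -Eq => hlt.
  have hs : (f q' d.+1 - i.-1 < k)%N by lia.
  case/negP: (hr _ hs); apply/mem_diagram_of; exists q', d.+1.
  by have := L_strict q'; split; lia.
case/mem_back_seq => q [d [m [dq /andP[lm mf] pm -> ->]]].
have [lb fn pf] := tableau_box ft dq.
have same u : (m <= u < f q d)%N -> (u.+1, u.+1 + d)%N \notin diagram_of f.
  move=> hu; apply: notin_diagram_ofI => q' dq'; have [h|h] := ltnP q' q.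
    by have [] := diag_lower_bound h dq; lia.
  by have := tableau_diag_le ft h dq'; lia.
split; first by apply/andP; split=> /=; lia.
  by apply: same; lia.
exists (f q d - m)%N; last first.
  move=> XD /= e; have d0 : d = 0%N by lia.
  rewrite d0 in pm pf mf *; move: pm pf; rewrite /parity_ok XD /= => /eqP pm /eqP pf.
  by rewrite oddB ?pm ?pf ?addbb // ltnW.
split=> /=.
- by lia.
- by apply/mem_diagram_of; exists q, d; split=> //; lia.
- move=> s hs; have hu : (m <= m + s < f q d)%N by lia.
  have -> : (m.+1 + s, m.+1 + d + s)%N = ((m + s).+1, (m + s).+1 + d)%N.
    by congr (_, _); lia.
  exact: same.
- move=> s hs; have -> : (m.+1 + s, (m.+1 + d + s).+1)%N = ((m + s).+1, (m + s).+1 + d.+1)%N.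
    by congr (_, _); lia.
  apply: notin_diagram_ofI => q' dq'; have [h|h] := ltnP q' q.
    by have [] := diag_lower_bound h dq; lia.
  have := tableau_diag_le ft h dq'.
  have dq1 : (d.+1 < L q)%N.
    by move: h; rewrite leq_eqVlt => /predU1P[->//|/(strict_shape_lt L_strict)]; lia.
  by have := tableau_row ft dq1; lia.
move=> hd s hs; case Ed: d => [|d']; first by lia.
have -> : ((m.+1 + s).+1, (m.+1 + d'.+1 + s))%N = ((m + s).+2, (m + s).+2 + d')%N.
  by congr (_, _); lia.
apply: notin_diagram_ofI => q' dq'; have [h|h] := leqP q' q.
  have := tableau_diag_le ft h (_ : d' < L q)%N.
  have : (f q d' <= lower_bound f q d)%N by rewrite /lower_bound Ed leq_maxl.
  by move=> h1 h2; have := h2 (ltnW _); rewrite -Ed => /(_ dq); lia.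
have := tableau_diag_le ft h dq'.
have dq1 : (d' < L q.+1)%N.
  by move: h; rewrite leq_eqVlt => /predU1P[->//|/(strict_shape_lt L_strict)]; lia.
by have := tableau_col ft dq1; rewrite -Ed; lia.
Qed.

End BackBoxes.

Lemma diagram_weight_tableau (F : fieldType) (beta : F) (x b : nat -> F) f :
  tab f ->
  diagram_weight X beta n x b (diagram_of f) =
  \prod_(c <- boxes)
    box_factor beta (fun i d => box_weight X beta n x b (i.+1, i.+1 + d)%N) isD f c.1 c.2.
Proof.
move=> ft; rewrite /diagram_weight prod_diagram_of // back_boxesE //.
rewrite -fsbig_seq; last exact: back_seq_uniq.
rewrite [X in _ * X]big_allpairs_dep -big_split /=; apply: eq_bigr => c _.
by rewrite big_filter.
Qed.

End Diagrams.

Local Open Scope classical_set_scope.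
Local Open Scope fset_scope.
Local Open Scope ring_scope.

(** * Conclusion *)

Section SumExcited.
Variables (F : fieldType) (beta : F) (X : lie_type) (n M : nat) (la : seq nat).
Variables (x b : nat -> F).
Hypothesis la_strict : strict_partition la.
Hypotheses (nM : (n <= M)%N) (sM : (size la <= M)%N) (lM : all (leq^~ M) la).
Hypothesis sn : (size la <= n)%N.
Local Notation L := (nth 0%N la).
Local Notation w := (fun i d : nat => box_weight X beta n x b (i.+1, i.+1 + d)%N).

Lemma shape_weight_boxes (w' : nat -> nat -> F) isD f :
  shape_weight beta w' isD M L f =
  \prod_(c <- boxes la) box_factor beta w' isD f c.1 c.2.
Proof.
have io m : iota 0 m = index_iota 0 m by rewrite /index_iota subn0.
rewrite big_allpairs_dep io big_mkord.
rewrite (big_ord_widen_cond M.+1 xpredT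
  (fun q => \prod_(d <- iota 0 (L q)) box_factor beta w' isD f q d)) //; last exact: leqW.
rewrite [RHS]big_mkcond; apply: eq_bigr => q _.
case: ltnP => [_|h] /=; first by rewrite io big_mkord.
by rewrite nth_default ?big_ord0.
Qed.

Lemma tableau_entry f : tableau (is_typeD X) (fun=> n) L f ->
  exists a : {ffun 'I_M.+1 * 'I_M.+1 -> 'I_M.+1}, entry a = f.
Proof.
move=> ft; exists [ffun c : (ordinal M.+1 * ordinal M.+1)%type => inord (f c.1 c.2)].
have LM q : (L q <= M)%N.
  have [h|h] := ltnP q (size la); last by rewrite nth_default.
  by move/allP: lM; apply; exact: mem_nth.
apply: funext => q; apply: funext => d; rewrite /entry ffunE /=; have := ft q d.
case: ifP => [dq [_ fn _]|dq fqd].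
  have qs : (q < size la)%N.
    by rewrite ltnNge; apply/negP => h; rewrite nth_default in dq.
  rewrite (leq_trans (ltnW qs) sM) (leq_trans (ltnW dq) (LM q)) /=.
  by rewrite !inordK //; have := LM q; lia.
case: ifP => // /andP[qM dM].
by rewrite !inordK ?ltnS // fqd.
Qed.

Lemma sum_excited :
  \sum_(D \in excited X n la) diagram_weight X beta n x b D =
  tableau_sum beta w (is_typeD X) M (partial_rows n 0) L.
Proof.
have rowsE : partial_rows n 0 = fun=> n.
  by apply: funext => d; rewrite /partial_rows ltn0 addn0.
pose P : set {ffun 'I_M.+1 * 'I_M.+1 -> 'I_M.+1} :=
  [set a | tableau (is_typeD X) (fun=> n) L (entry a)].
have -> : excited X n la = ((fun a => diagram_of la (entry a)) @` P)%classic.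
  rewrite excitedE //; apply/seteqP; split=> [_ [f /= ft <-]|_ [a ha <-]].
    by have [a ea] := tableau_entry ft; exists a; rewrite ?ea // /P /= ea.
  by exists (entry a).
rewrite fsbig_image; last first.
  move=> a a'; rewrite !inE => ha ha' e; apply: entry_inj => q d.
  by rewrite (diagram_of_inj la_strict ha ha' e).
rewrite /tableau_sum rowsE.
rewrite [RHS]bigfs ?index_enum_uniq //; last by move=> a _; rewrite mem_index_enum.
have -> : [set` (fun a => `[< tableau (is_typeD X) (fun=> n) L (entry a) >])] = P.
  by apply/seteqP; split=> a; rewrite /= unfold_in => /asboolP.
apply: eq_fsbigr => a /set_mem ha.
by rewrite diagram_weight_tableau // shape_weight_boxes.
Qed.

End SumExcited.

Lemma symmetrization_cross_sum (F : fieldType) (beta : F) (n : nat) (la : seq nat)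
    (x : nat -> F) (phi : nat -> F -> F) :
  [pchar F] =i pred0 -> (size la <= n)%N ->
  ((n - size la)`!%:R)^-1 *
  \sum_(w : 'S_n)
    (\prod_(j < n | (j < size la)%N) phi (nth 0%N la j) (x (w j).+1)) *
    cross_factor beta (size la) (fun i => x (w i).+1) =
  cross_sum_seq beta (fun i : 'I_n => x i.+1) (map phi la) [set: 'I_n]%SET.
Proof.
move=> charF hn; set fs := map _ _.
have sfs : size fs = size la by rewrite size_map.
have hn' : (size fs <= n)%N by rewrite sfs.
have fact_neq0 : (n - size la)`!%:R != 0 :> F.
  by rewrite ((pcharf0P _).1 charF) -lt0n fact_gt0.
have := @sum_perm_cross F beta n (fun i => x i.+1) fs hn'.
rewrite sfs => e; apply: (mulfI fact_neq0); rewrite -e mulrA mulfV // mul1r.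
apply: eq_bigr => w _ /=; congr (_ * _); apply: eq_bigr => j jla.
by rewrite (nth_map 0%N).
Qed.

Lemma GP_cross_sum (F : fieldType) (beta : F) (n : nat) (la : seq nat)
    (x b : nat -> F) : [pchar F] =i pred0 -> (size la <= n)%N ->
  GP beta n la x b =
  cross_sum_seq beta (fun i : 'I_n => x i.+1)
    (map (fun l y => \prod_(1 <= k < l.+1) oplus beta y (b k)) la) [set: 'I_n]%SET.
Proof. by move=> charF hn; rewrite -symmetrization_cross_sum. Qed.

Lemma GQ_cross_sum (F : fieldType) (beta : F) (n : nat) (la : seq nat)
    (x b : nat -> F) : [pchar F] =i pred0 -> (size la <= n)%N ->
  GQ beta n la x b =
  cross_sum_seq beta (fun i : 'I_n => x i.+1)
    (map (fun l y => oplus beta y y * \prod_(1 <= k < l) oplus beta y (b k)) la)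
    [set: 'I_n]%SET.
Proof. by move=> charF hn; rewrite -symmetrization_cross_sum. Qed.

Lemma GX_cross_sum (F : fieldType) (X : lie_type) (beta : F) (n : nat)
    (la : seq nat) (x b : nat -> F) : [pchar F] =i pred0 ->
  strict_partition la -> (size la <= n)%N ->
  GX X beta n la x b =
  cross_sum_seq beta (fun i : 'I_n => x i.+1)
    (map (part_factor beta (~~ is_typeD X)
       (match X with TypeB => id | TypeC => fun y => oplus beta y y | TypeD => fun=> 1 end)
       (fun j => b j.+1)) la) [set: 'I_n]%SET.
Proof.
move=> charF sla hn; have la_gt0 l : l \in la -> (0 < l)%N.
  by move=> hl; rewrite lt0n; apply: contraTneq hl => ->; case/andP: sla.
case: X => /=; rewrite ?GP_cross_sum ?GQ_cross_sum //; congr (cross_sum_seq _ _ _ _);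
  apply/eq_in_map => l /la_gt0; case: l => // l _; apply: funext => y;
  rewrite /part_factor /= ?subn0 ?subn1 big_add1 /= ?big_mkord //.
(* In type B the leading parameter 0 gives y ⊕ 0 = y, which is [g0]. *)
- rewrite big_ord_recl /shift0 /= /oplus mulr0 !addr0; congr (_ * _).
- by rewrite mul1r.
Qed.

Theorem theorem9p6 (F : fieldType) (charF : [pchar F] =i pred0)
    (X : lie_type) (n : nat) (la : seq nat) (beta : F) (x b : nat -> F)
    (hla : strict_partition la) (hlen : (size la <= n)%N)
    (heven : X = TypeD -> ~~ odd n)
    (* the denominators occurring in the left-hand side do not vanish *)
    (hx : forall i j : nat, (1 <= i <= n)%N -> (1 <= j <= n)%N ->
            i <> j -> x i <> x j)
    (hx1 : forall i : nat, (1 <= i <= n)%N -> 1 + beta * x i != 0) :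
  GX X beta n la x b =
  \sum_(D \in excited X n la) diagram_weight X beta n x b D.
Proof.
(* Dominates [n], the number of parts and each part; the successor makes it positive. *)
pose M := (n + size la + sumn la).+1.
have lM : all (leq^~ M) la.
  apply/allP => l hl; have : (l <= sumn la)%N.
    by rewrite sumnE (big_rem l) //= leq_addr.
  by rewrite /M; lia.
(* The sequence x_1, ..., x_n, b_1, b_2, ... merges the two cases of the weights in [w_off] into one
   formula. *)
pose z j := if (j < n)%N then x j.+1 else b (j - n).+1.
have x_inj : injective (fun i : 'I_n => x i.+1).
  move=> i j e; apply/val_inj/eqP; apply/negPn/negP => /eqP ij.
  by apply: (hx i.+1 j.+1) e; rewrite ?ltn_ord //; move=> [].
have x_unit (i : 'I_n) : 1 + beta * x i.+1 != 0 by apply: hx1; rewrite /= ltn_ord.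
have two_neq0 : 2%:R != 0 :> F by rewrite ((pcharf0P _).1 charF).
rewrite (@sum_excited F beta X n M la) //; try (rewrite /M; lia).
rewrite GX_cross_sum //.
have <- : (fun j => z (n + j)%N) = (fun j => b j.+1).
  by apply: funext => j; rewrite /z ltnNge leq_addr addKn.
apply: cross_sum_tableau_sum => //.
- by move=> i; rewrite /z ltn_ord.
- by rewrite /M; lia.
- move=> i k; rewrite /z; case: (X) => /= hk; rewrite ?addn0 ?addn1.
  + rewrite ifN; last by apply/eqP; lia.
    by rewrite addSn; case: ltnP => // h; rewrite subSn.
  + by rewrite addSn; case: ltnP => // h; rewrite subSn.
  + by rewrite addSn; case: ltnP => // h; rewrite subSn.
- by case: (X).
- by move=> i; case: (X) => //= _; rewrite addn0 ?eqxx // ltn_ord.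
- case: (X) => // _ A /=; last first.
    by rewrite -double_part_sum //; apply: eq_bigr => i _; rewrite mulr1.
  (* In type B [g0] is the identity, i.e. the parameter 0, for which the parity in the one-part sum
     has no effect. *)
  have := @one_part_sum _ beta _ _ x_inj x_unit A 0.
  rewrite if_same oplus0x => <-; apply: eq_bigr => i _.
  by rewrite mulr1 [oplus beta (x i.+1) 0]oplusC oplus0x.
- by rewrite lM /M /=; lia.
Qed.
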